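(* Consider a system of $N$ qubits placed on the sites of a lattice, with a target Hamiltonian $H$ (a Hermitian operator on the $N$-qubit Hilbert space) and an actual Hamiltonian $$H' = H + \sum_{i=1}^M g_i V_i,$$ where $M=\mathcal{O}(N)$, each $V_i$ is a local Hermitian operator with $\|V_i\|\le 1$, and $g_1,\dots,g_M$ are independent $\chi$-deformed Gaussian random variables with parameters $\delta>0$ and $\Gamma\in(0,+\infty]$. Suppose $\sqrt{N}\,t\,\delta\le \mathcal{O}(1)$. Then for any density matrix $\rho$ and any observable $O$, $$\big|\mathrm{tr}[\rho\, e^{iH't}Oe^{-iH't}] - \mathrm{tr}[\rho\, e^{iHt}Oe^{-iHt}]\big| \leq \mathcal{O}(a\sqrt{N}t\delta\|O\|) + \mathcal{O}(Nt^2\delta^2\|O\|)$$ holds with probability at least $1-2e^{-ca^2}$, for arbitrary $a>0$ and some absolute constant $c>0$.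
   Context: A random variable $g$ is a $\chi$-deformed Gaussian random variable (with parameters $\delta>0$, $\Gamma\in(0,+\infty]$) if $g=\chi(\theta)$ for some $\theta\sim\mathcal{N}(0,1)$, where $\chi:\mathbb{R}\to\mathbb{R}$ is a strictly monotonically increasing differentiable function with $|\mathrm{d}\chi(\theta)/\mathrm{d}\theta|\le\delta$ for all $\theta$, $\chi(0)=0$, $\lim_{\theta\to+\infty}\chi(\theta)=\Gamma$, $\lim_{\theta\to-\infty}\chi(\theta)=-\Gamma$, and $\mathbb{E}[\chi(\theta)]=0$. Independence of the $g_i$ means the underlying Gaussians $\theta_i$ are independent. $\|\cdot\|$ denotes the operator (spectral) norm. The $\mathcal{O}(\cdot)$ notation hides constants independent of $N$, $t$, $\delta$, $a$, $\rho$, $O$. *)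

(* Defs.v *)
From HB Require Import structures.
From mathcomp Require Import all_boot all_order all_algebra.
From mathcomp Require Import all_classical all_reals all_analysis.
From mathcomp Require Import complex.

Set Implicit Arguments.
Unset Strict Implicit.
Unset Printing Implicit Defensive.

Import Order.TTheory GRing.Theory Num.Theory.
Import numFieldNormedType.Exports.
Local Open Scope classical_set_scope.

Local Open Scope ring_scope.
Local Open Scope complex_scope.

Section QubitDefs.
Variable R : realType.
Local Notation C := R[i].

Definition vnorm2 n (v : 'cV[C]_n) : R :=
  \sum_(k < n) (complex.Re (v k 0) ^+ 2 + complex.Im (v k 0) ^+ 2).

Definition opnorm n (A : 'M[C]_n) : R :=
  sup [set x : R | exists v : 'cV[C]_n,
                     vnorm2 v = 1 /\ x = Num.sqrt (vnorm2 (A *m v))].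

Definition mxpow n (A : 'M[C]_n) (k : nat) : 'M[C]_n := iter k (mulmx A) 1%:M.

Definition expm_partial n (A : 'M[C]_n) (K : nat) : 'M[C]_n :=
  \sum_(k < K) ((k`!)%:R^-1 : C) *: mxpow A k.

Definition expm n (A : 'M[C]_n) : 'M[C]_n :=
  \matrix_(i, j) ((limn (fun K => complex.Re (expm_partial A K i j)))
                   +i* (limn (fun K => complex.Im (expm_partial A K i j)))).

Definition hermitian_mx n (A : 'M[C]_n) : Prop :=
  forall i j, A j i = (A i j)^*.

Definition psd n (A : 'M[C]_n) : Prop :=
  forall v : 'cV[C]_n,
    0 <= complex.Re (\sum_(i < n) \sum_(j < n) (v i 0)^* * A i j * v j 0).

Definition density_matrix n (rho : 'M[C]_n) : Prop :=
  hermitian_mx rho /\ psd rho /\ \tr rho = 1.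

Definition heis_expect n (rho H O : 'M[C]_n) (t : R) : C :=
  \tr (rho *m expm ((0 +i* t) *: H) *m O *m expm ((0 +i* (- t)) *: H)).

(* N-qubit Hilbert space C^(2^N): basis vector x : 'I_(2^N) has qubit j in
   state |bit x j>, the j-th binary digit of x. *)
Definition bit (N : nat) (x : 'I_(2 ^ N)) (j : 'I_N) : bool := odd (x %/ 2 ^ j).

(* A acts only on the qubits of S, i.e. A = W_S (x) Id_{complement of S} *)
Definition supported_on (N : nat) (S : {set 'I_N}) (A : 'M[C]_(2 ^ N)) : Prop :=
  (forall x y, (exists j, j \notin S /\ bit x j != bit y j) -> A x y = 0) /\
  (forall x y x' y',
      (forall j, j \notin S -> bit x j = bit y j) ->
      (forall j, j \notin S -> bit x' j = bit y' j) ->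
      (forall j, j \in S -> bit x j = bit x' j /\ bit y j = bit y' j) ->
      A x y = A x' y').

Definition lattice_embedding (N D : nat) (pos : 'I_N -> 'I_D -> int) : Prop :=
  injective pos.

Definition local_op (N D : nat) (pos : 'I_N -> 'I_D -> int) (r : nat)
    (A : 'M[C]_(2 ^ N)) : Prop :=
  exists S : {set 'I_N}, supported_on S A /\
    (forall j k, j \in S -> k \in S -> forall d, (`|pos j d - pos k d| <= r%:Z)%R).

End QubitDefs.

Section ChiDeformed.
Variable R : realType.

Definition chi_deformation (chi : R -> R) (delta : R) (Gamma : \bar R) : Prop :=
  (forall x y, x < y -> chi x < chi y) /\
  (forall x, derivable chi x 1 /\ `|derive1 chi x| <= delta) /\
  chi 0 = 0 /\
  ((chi x)%:E @[x --> +oo] --> Gamma) /\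
  ((chi x)%:E @[x --> -oo] --> (- Gamma)%E).

Definition mutually_independent (d : measure_display) (T : measurableType d)
    (P : probability T R) (I : finType) (X : I -> {RV P >-> R}) : Prop :=
  forall B : I -> set R, (forall i, measurable (B i)) ->
    P (\bigcap_(i in [set: I]) (X i @^-1` B i)) = (\prod_(i : I) P (X i @^-1` B i))%E.

End ChiDeformed.

(* Main.v *)
(* With f(g) the expectation for the couplings g, the proof bounds
   E exp(lambda (f(g) - f(0))) one coordinate at a time. Each coordinate slice
   phi of f satisfies |phi(y) - phi(0)| <= 2 |O| t |y| and
   |phi(y) - phi(0) - m y| <= 3 |O| t^2 y^2, so with y = chi(theta) centered the
   linear term averages to 0 given the other coordinates, and the slice
   contributes at most exp(lambda b + lambda^2 L^2) with b = O(|O| t^2 delta^2)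
   and L = 2 |O| t delta. Multiplying over the M = O(N) coordinates gives bias
   M b and variance proxy M L^2 at once, and Markov's inequality for +f and -f
   concludes; no Gaussian isoperimetry is needed.
   The slice estimates come from exp(A) = lim (1 + A/n)^n: for Hermitian K the
   norm of (1 + i s K / n)^n is at most exp(O(1/n)), so telescoping products
   yields first- and second-order bounds with constants independent of |K|. *)

Require Import Defs.
From HB Require Import structures.
From mathcomp Require Import all_boot all_order all_algebra.
From mathcomp Require Import all_classical all_reals all_analysis.
From mathcomp Require Import complex ring lra spectral measurable_realfun.

Set Implicit Arguments.
Unset Strict Implicit.
Unset Printing Implicit Defensive.

Import Order.TTheory GRing.Theory Num.Theory.
Import numFieldNormedType.Exports.
Local Open Scope classical_set_scope.
Local Open Scope ring_scope.
Local Open Scope complex_scope.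

(** * Operator bounds *)

Section NormBounds.
Variable R : realType.
Local Notation C := R[i].

(** The second-order slice estimate is what separates the two error terms. A Lipschitz bound
    controls the fluctuation of f(g) - f(0), but alone it would allow a mean of order M |O| t delta;
    keeping the linear term exact lets centering remove it and leaves a mean of order M |O| (t
    delta)^2.

    The averaging given the other coordinates uses no conditional expectation. Couplings are
    switched on one at a time, those not yet reached being frozen at 0, so the value at stage k is a
    function of the first k Gaussians. Each increment is then dominated by products of a function of
    the past and a function of the new Gaussian, and independence with Fubini suffices. The price is
    that the slope m, which depends on the past, must be shown measurable and bounded.

    All moments are reduced to the one Gaussian fact E exp(s theta) = exp(s^2 / 2): the square
    theta^2 is dominated by 4 (exp theta + exp(- theta)), of mean 8 exp(1/2). Together with the 3 of
    the second-order estimate this is the origin of the constant 24 exp(1/2). *)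

Lemma ReD (x y : C) : complex.Re (x + y) = complex.Re x + complex.Re y.
Proof. by case: x y => [a b] []. Qed.

Lemma ImD (x y : C) : complex.Im (x + y) = complex.Im x + complex.Im y.
Proof. by case: x y => [a b] []. Qed.

Lemma ReM (x y : C) : complex.Re (x * y) =
  complex.Re x * complex.Re y - complex.Im x * complex.Im y.
Proof. by case: x y => [a b] []. Qed.

Lemma ImM (x y : C) : complex.Im (x * y) =
  complex.Re x * complex.Im y + complex.Im x * complex.Re y.
Proof. by case: x y => [a b] []. Qed.

Lemma ReN (x : C) : complex.Re (- x) = - complex.Re x.
Proof. by case: x. Qed.

Lemma ReB (x y : C) : complex.Re (x - y) = complex.Re x - complex.Re y.
Proof. by rewrite ReD ReN. Qed.

Lemma Re_sum (I : Type) (r : seq I) (P : pred I) (F : I -> C) :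
  complex.Re (\sum_(i <- r | P i) F i) = \sum_(i <- r | P i) complex.Re (F i).
Proof. by apply: (big_morph _ ReD). Qed.

Lemma Im_sum (I : Type) (r : seq I) (P : pred I) (F : I -> C) :
  complex.Im (\sum_(i <- r | P i) F i) = \sum_(i <- r | P i) complex.Im (F i).
Proof. by apply: (big_morph _ ImD). Qed.

Lemma vnorm2_ge0 n (v : 'cV[C]_n) : 0 <= vnorm2 v.
Proof. by apply: sumr_ge0 => k _; rewrite addr_ge0 ?sqr_ge0. Qed.

Lemma vnorm2_eq0 n (v : 'cV[C]_n) : vnorm2 v = 0 -> v = 0.
Proof.
move/eqP; rewrite /vnorm2 psumr_eq0; last by move=> k _; rewrite addr_ge0 ?sqr_ge0.
move=> /allP h; apply/colP => k; rewrite mxE.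
have /= := h k (mem_index_enum k); rewrite paddr_eq0 ?sqr_ge0// !sqrf_eq0.
by case: (v k 0) => a b /= /andP[/eqP -> /eqP ->].
Qed.

Lemma vnorm2_0 n : vnorm2 (0 : 'cV[C]_n) = 0.
Proof. by rewrite /vnorm2 big1// => k _; rewrite mxE /= expr0n addr0. Qed.

Lemma vnorm2Z n (c : C) (v : 'cV[C]_n) : vnorm2 (c *: v) = Normc.normc c ^+ 2 * vnorm2 v.
Proof.
rewrite /vnorm2 mulr_sumr; apply: eq_bigr => k _; rewrite mxE.
case: c (v k 0) => [a b] [x y] /=.
by rewrite sqr_sqrtr ?addr_ge0 ?sqr_ge0//; ring.
Qed.

(** Young's inequality: in each real coordinate the two sides differ by e (p - q / e)^2. The choice
    e = b / a in [bndD] turns it into the triangle inequality, without Cauchy-Schwarz. *)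
Lemma vnorm2D_le n (e : R) (u v : 'cV[C]_n) : 0 < e ->
  vnorm2 (u + v) <= (1 + e) * vnorm2 u + (1 + e^-1) * vnorm2 v.
Proof.
move=> e0; rewrite /vnorm2 !mulr_sumr -big_split /=; apply: ler_sum => k _.
rewrite mxE; case: (u k 0) (v k 0) => [a b] [x y] /=.
have am (p q : R) : (p + q) ^+ 2 <= (1 + e) * p ^+ 2 + (1 + e^-1) * q ^+ 2.
  rewrite -subr_ge0.
  have -> : (1 + e) * p ^+ 2 + (1 + e^-1) * q ^+ 2 - (p + q) ^+ 2
    = e * (p - e^-1 * q) ^+ 2 by field; rewrite gt_eqF.
  by rewrite mulr_ge0 ?sqr_ge0// ltW.
by have := am a x; have := am b y; lra.
Qed.

(** An upper bound on the operator norm in squared form, so that sums and products involve no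
    supremum or square root; [bnd_opnorm] is the link with [opnorm]. *)
Definition bnd n (A : 'M[C]_n) (a : R) : Prop :=
  0 <= a /\ forall v : 'cV[C]_n, vnorm2 (A *m v) <= a ^+ 2 * vnorm2 v.

Lemma bnd_ge0 n (A : 'M[C]_n) a : bnd A a -> 0 <= a. Proof. by case. Qed.

Lemma bnd_le n (A : 'M[C]_n) a b : a <= b -> bnd A a -> bnd A b.
Proof.
move=> ab [a0 h]; split; first exact: le_trans ab.
move=> v; apply: le_trans (h v) _; apply: ler_wpM2r; first exact: vnorm2_ge0.
by rewrite lerXn2r ?nnegrE// (le_trans a0).
Qed.

Lemma bnd0 n : bnd (0 : 'M[C]_n) 0.
Proof. by split => // v; rewrite mul0mx vnorm2_0 expr0n mul0r. Qed.

Lemma bnd1 n : bnd (1%:M : 'M[C]_n) 1.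
Proof. by split => // v; rewrite mul1mx expr1n mul1r. Qed.

Lemma bndM n (A B : 'M[C]_n) a b : bnd A a -> bnd B b -> bnd (A *m B) (a * b).
Proof.
move=> [a0 hA] [b0 hB]; split; first exact: mulr_ge0.
move=> v; rewrite -mulmxA; apply: le_trans (hA _) _.
by rewrite exprMn -[leRHS]mulrA ler_wpM2l ?sqr_ge0.
Qed.

Lemma bndZ n (A : 'M[C]_n) a (c : C) : bnd A a -> bnd (c *: A) (Normc.normc c * a).
Proof.
move=> [a0 hA]; split.
  by rewrite mulr_ge0//; case: (c) => x y /=; rewrite sqrtr_ge0.
move=> v; rewrite -scalemxAl vnorm2Z exprMn -[leRHS]mulrA.
by apply: ler_wpM2l; [exact: sqr_ge0|exact: hA].
Qed.

Lemma bndD n (A B : 'M[C]_n) a b : bnd A a -> bnd B b -> bnd (A + B) (a + b).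
Proof.
move=> hA hB; have [a0 Ha] := hA; have [b0 Hb] := hB.
(* The ratio b / a used below must be positive, so the bound 0 is treated apart. *)
have nul (X : 'M[C]_n) : bnd X 0 -> X = 0.
  move=> [_ h]; apply/matrixP => i j; rewrite mxE.
  have : vnorm2 (X *m delta_mx j 0) = 0.
    apply/eqP; rewrite eq_le vnorm2_ge0 andbT.
    by apply: le_trans (h _) _; rewrite expr0n mul0r.
  by move/vnorm2_eq0; rewrite -colE => /colP/(_ i); rewrite !mxE.
move: a0; rewrite le_eqVlt => /orP[/eqP a0|a0].
  by move: hA; rewrite -a0 => /nul ->; rewrite !add0r.
move: b0; rewrite le_eqVlt => /orP[/eqP b0|b0].
  by move: hB; rewrite -b0 => /nul ->; rewrite !addr0.
split; first by rewrite addr_ge0// ltW.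
move=> v; rewrite mulmxDl.
apply: le_trans (@vnorm2D_le _ (b / a) _ _ _) _; first exact: divr_gt0.
have -> : (a + b) ^+ 2 * vnorm2 v = (1 + b / a) * (a ^+ 2 * vnorm2 v)
   + (1 + (b / a)^-1) * (b ^+ 2 * vnorm2 v).
  by field; rewrite !gt_eqF.
have p1 : 0 <= 1 + b / a by rewrite addr_ge0// ltW// divr_gt0.
have p2 : 0 <= 1 + (b / a)^-1 by rewrite addr_ge0// ltW// invr_gt0 divr_gt0.
by rewrite lerD// ler_wpM2l.
Qed.

Lemma normc_real (x : R) : Normc.normc (x +i* 0) = `|x|.
Proof. by rewrite /= expr0n addr0 sqrtr_sqr. Qed.

Lemma normc_imag (x : R) : Normc.normc (0 +i* x) = `|x|.
Proof. by rewrite /= expr0n add0r sqrtr_sqr. Qed.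

(** Expansion in matrix units, each of norm at most 1. It makes the supremum in [opnorm] finite and
    supplies the auxiliary radius k that disappears in the limits. *)
Lemma bnd_exists n (A : 'M[C]_n) : exists a, bnd A a.
Proof.
rewrite [A]matrix_sum_delta.
apply: (big_ind (fun X : 'M[C]_n => exists a, bnd X a)).
- by exists 0; apply: bnd0.
- by move=> X Y [x hx] [y hy]; exists (x + y); apply: bndD.
move=> i _; apply: (big_ind (fun X : 'M[C]_n => exists a, bnd X a)).
- by exists 0; apply: bnd0.
- by move=> X Y [x hx] [y hy]; exists (x + y); apply: bndD.
move=> j _; exists (Normc.normc (A i j) * 1); apply: bndZ; split => // v.
rewrite expr1n mul1r.
have -> : delta_mx i j *m v = v j 0 *: delta_mx i 0.
  apply/colP => k; rewrite !mxE (bigD1 j)//= big1 => [|l lj]; rewrite !mxE.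
    by rewrite eqxx andbT addr0 mulrC.
  by rewrite (negbTE lj) andbF mul0r.
rewrite /vnorm2 (bigD1 i)//= big1 => [|k ki].
  rewrite !mxE !eqxx /= mulr1 addr0 (bigD1 j)//= lerDl sumr_ge0// => k _.
  by rewrite addr_ge0 ?sqr_ge0.
by rewrite !mxE (negbTE ki) /= mulr0 /= expr0n addr0.
Qed.

Lemma bnd_opnorm n (A : 'M[C]_n) : bnd A (opnorm A).
Proof.
have [a [a0 ha]] := bnd_exists A.
set S := [set x : R | exists v : 'cV[C]_n,
  vnorm2 v = 1 /\ x = Num.sqrt (vnorm2 (A *m v))].
have ubS : has_ubound S.
  exists a => _ [v [v1 ->]]; rewrite -[leRHS]ger0_norm// -sqrtr_sqr ler_wsqrtr//.
  by apply: le_trans (ha v) _; rewrite v1 mulr1.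
have opE : opnorm A = sup S by [].
have unit_le (v : 'cV[C]_n) : vnorm2 v = 1 -> vnorm2 (A *m v) <= opnorm A ^+ 2.
  move=> v1; rewrite -[leLHS]sqr_sqrtr ?vnorm2_ge0//.
  have le : Num.sqrt (vnorm2 (A *m v)) <= opnorm A.
    by rewrite opE; apply: ub_le_sup => //; exists v.
  by rewrite lerXn2r ?nnegrE ?sqrtr_ge0// (le_trans _ le) ?sqrtr_ge0.
split.
  (* In dimension 0 there is no unit vector, and the supremum of the empty set is 0. *)
  rewrite opE; have [S0|/set0P[x Sx]] := eqVneq S set0.
    by rewrite S0 sup0.
  apply: le_trans (ub_le_sup ubS Sx); case: Sx => v [_ ->]; exact: sqrtr_ge0.
move=> v; have [/vnorm2_eq0 ->|v0] := eqVneq (vnorm2 v) 0.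
  by rewrite mulmx0 vnorm2_0 mulr0.
have vp : 0 < vnorm2 v by rewrite lt_def v0 vnorm2_ge0.
set c := (Num.sqrt (vnorm2 v))^-1.
have c2 : c ^+ 2 = (vnorm2 v)^-1 by rewrite exprVn sqr_sqrtr// ltW.
have := unit_le ((c +i* 0) *: v).
rewrite -scalemxAr !vnorm2Z !normc_real !real_normK ?num_real// c2 mulVf//.
by move=> /(_ erefl); rewrite mulrC ler_pdivrMr.
Qed.

Lemma Im_hermitian_form n (K : 'M[C]_n) (v : 'cV[C]_n) : hermitian_mx K ->
  complex.Im (\sum_k (v k 0)^* * (K *m v) k 0) = 0.
Proof.
move=> hK; set q := (X in complex.Im X).
have : q^* = q.
  rewrite /q rmorph_sum /=.
  under eq_bigr => k _ do rewrite rmorphM /= conjcK mxE rmorph_sum /= mulr_sumr.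
  rewrite exchange_big /=; apply: eq_bigr => j _.
  rewrite mxE mulr_sumr; apply: eq_bigr => k _.
  by rewrite rmorphM /= -(hK k j); ring.
by case: q => a b /= [] /eqP; rewrite eq_sym -addr_eq0 -mulr2n mulrn_eq0 /= => /eqP.
Qed.

(* The cross term of |v + i e K v|^2 is Re (i e <v, K v>), which vanishes for
   Hermitian K. *)
Lemma vnorm2_1iK n (K : 'M[C]_n) (e : R) (v : 'cV[C]_n) : hermitian_mx K ->
  vnorm2 ((1%:M + (0 +i* e) *: K) *m v) = vnorm2 v + e ^+ 2 * vnorm2 (K *m v).
Proof.
move=> hK; rewrite mulmxDl mul1mx -scalemxAl.
have -> : vnorm2 (v + (0 +i* e) *: (K *m v)) =
   vnorm2 v + e ^+ 2 * vnorm2 (K *m v)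
   - (2 * e) * complex.Im (\sum_k (v k 0)^* * (K *m v) k 0).
  rewrite Im_sum /vnorm2 !mulr_sumr -sumrN -!big_split /=; apply: eq_bigr => k _.
  rewrite !mxE; case: (v k 0) (\sum_j _) => [a b] [x y] /=; ring.
by rewrite Im_hermitian_form// mulr0 subr0.
Qed.

(** The squared norm grows by at most 1 + (e k)^2 <= exp((e k)^2), so the loss is quadratic in e;
    the triangle inequality would lose exp(|e| k), which does not improve when steps are refined. *)
Lemma bnd_1iK n (K : 'M[C]_n) (e k : R) : hermitian_mx K -> bnd K k ->
  bnd (1%:M + (0 +i* e) *: K) (expR ((e * k) ^+ 2 / 2)).
Proof.
move=> hK [k0 h]; split; first exact: expR_ge0.
move=> v; rewrite vnorm2_1iK// -expRM_natl.
have -> : 2%:R * ((e * k) ^+ 2 / 2) = (e * k) ^+ 2 by field.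
apply: (@le_trans _ _ ((1 + (e * k) ^+ 2) * vnorm2 v)); last first.
  by rewrite ler_wpM2r ?vnorm2_ge0// expR_ge1Dx.
by rewrite mulrDl mul1r lerD2l exprMn -[leRHS]mulrA ler_wpM2l ?sqr_ge0.
Qed.

Lemma bndX n (A : 'M[C]_n) a j : bnd A a -> bnd (A ^+ j) (a ^+ j).
Proof.
move=> h; elim: j => [|j ih]; first by rewrite !expr0; apply: bnd1.
by rewrite !exprS; apply: bndM.
Qed.

End NormBounds.

(** * The matrix exponential as a limit of powers *)

Section ExponentialLimit.
Variable R : realType.
Local Notation C := R[i].

Lemma cvg_invSn : (n.+1%:R^-1 : R) @[n --> \oo] --> (0 : R).
Proof. exact: cvg_harmonic. Qed.

(** With y = a / (n+1), squeeze exp(y / (1 + y)) <= 1 + y <= exp y and raise to the power n+1. The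
    lower bound is 1 + z <= exp z at z = - y / (1 + y), inverted. *)
Lemma cvg_1Dx_div_n (a : R) : 0 <= a ->
  (1 + n.+1%:R^-1 * a) ^+ n.+1 @[n --> \oo] --> expR a.
Proof.
move=> a0.
have cx : (n.+1%:R^-1 * a) @[n --> \oo] --> (0 : R).
  by rewrite -[0 : R](mul0r a); apply: cvgMl; apply: cvg_invSn.
apply: (@squeeze_cvgr _ _ _ _ (fun n => expR (a / (1 + n.+1%:R^-1 * a))) (fun=> expR a)).
- near=> n.
  set y := n.+1%:R^-1 * a; have n0 : (0 : R) < n.+1%:R by rewrite ltr0n.
  have y0 : 0 <= y by rewrite mulr_ge0// invr_ge0 ltW.
  have y1 : 0 < 1 + y by rewrite ltr_pwDl.
  have aE : a = n.+1%:R * y by rewrite /y mulrA divff ?mul1r// gt_eqF.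
  apply/andP; split.
    have -> : a / (1 + y) = n.+1%:R * (y / (1 + y)) by rewrite {1}aE mulrA.
    rewrite expRM_natl; apply: lerXn2r; rewrite ?nnegrE ?expR_ge0 ?(ltW y1)//.
    have := expR_ge1Dx (- (y / (1 + y))).
    have -> : 1 + - (y / (1 + y)) = (1 + y)^-1 by field; rewrite gt_eqF.
    by rewrite expRN lef_pV2 ?posrE ?expR_gt0.
  rewrite [in leRHS]aE expRM_natl; apply: lerXn2r; rewrite ?nnegrE ?expR_ge0 ?(ltW y1)//.
  exact: expR_ge1Dx.
- have -> : expR a = expR (a / (1 + 0)) by rewrite addr0 divr1.
  apply: continuous_cvg; first exact: continuous_expR.
  apply: cvgMr; apply: cvgV; first by rewrite addr0 oner_neq0.
  by apply: cvgD; [exact: cvg_cst|].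
- exact: cvg_cst.
Unshelve. all: by end_near. Qed.

Lemma binomial_div_expn_le (n k : nat) : (n.+1%:R^-1 ^+ k *+ 'C(n.+1, k) : R) <= k`!%:R^-1.
Proof.
rewrite -[leLHS]mulr_natl exprVn ler_pdivrMr ?exprn_gt0 ?ltr0n//.
rewrite mulrC ler_pdivlMr ?ltr0n ?fact_gt0// -natrX -natrM ler_nat bin_ffact.
elim: k => [|k ih]; first by rewrite ffactn0 expn0.
by rewrite ffactnSr expnSr leq_mul// leq_subr.
Qed.

(* Dominated convergence for the binomial coefficients C(n,k) / n^k -> 1 / k!. *)
Lemma cvg_binomial_exp_series (u : R^nat) (a : R) : 0 <= a ->
  (forall k, `|u k| <= a ^+ k) ->
  let L := limn (fun K => \sum_(k < K) k`!%:R^-1 * u k) in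
  (fun K => \sum_(k < K) k`!%:R^-1 * u k) @ \oo --> L /\
  (fun n => \sum_(k < n.+2) n.+1%:R^-1 ^+ k *+ 'C(n.+1, k) * u k) @ \oo --> L.
Proof.
move=> a0 ua L; set S := (fun K => \sum_(k < K) _) in L *.
have cS : cvgn S.
  have -> : S = series (fun k => k`!%:R^-1 * u k).
    by apply/funext => K; rewrite /S /series/= big_mkord.
  apply: normed_cvg; apply: (@series_le_cvg _ _ (exp_coeff a)).
  - by move=> n; rewrite normr_ge0.
  - by move=> n; rewrite /exp_coeff divr_ge0 ?exprn_ge0.
  - move=> n /=; rewrite normrM ger0_norm ?invr_ge0// mulrC /exp_coeff/=.
    by rewrite ler_wpM2r ?invr_ge0.
  - exact: is_cvg_series_exp_coeff.
have SL : S @ \oo --> L by [].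
split => //.
(* The expansion of a power n+1 has n+2 terms, hence the shift by 2. *)
have SL2 : S n.+2 @[n --> \oo] --> L.
  by have := SL; rewrite -(cvg_shiftn 2) => h; under eq_fun do rewrite -addn2.
have dif : (S n.+2 - \sum_(k < n.+2) n.+1%:R^-1 ^+ k *+ 'C(n.+1, k) * u k)
    @[n --> \oo] --> (0 : R).
  apply/norm_cvg0P.
  (* The gaps 1/k! - C(n+1,k) / (n+1)^k are nonnegative, so the error is at most the same difference
     with a^k in place of u k, where both terms tend to exp a. *)
  apply: (@squeeze_cvgr _ _ _ _ (fun=> 0)
    (fun n => series (exp_coeff a) n.+2 - (1 + n.+1%:R^-1 * a) ^+ n.+1)).
  - near=> n; rewrite normr_ge0 /=.
    rewrite (addrC 1) exprD1n /series/= big_mkord -!sumrB.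
    apply: le_trans (ler_norm_sum _ _ _) _; apply: ler_sum => k _.
    rewrite -mulrBl normrM ger0_norm ?subr_ge0 ?binomial_div_expn_le//.
    apply: (@le_trans _ _ ((k`!%:R^-1 - n.+1%:R^-1 ^+ k *+ 'C(n.+1, k)) * a ^+ k)).
      by rewrite ler_wpM2l ?subr_ge0 ?binomial_div_expn_le.
    rewrite mulrBl /exp_coeff/= [_ / _]mulrC lerD2l lerN2 exprMn.
    by rewrite mulrnAl.
  - exact: cvg_cst.
  - rewrite -[0 : R](subrr (expR a)); apply: cvgB; last exact: cvg_1Dx_div_n.
    have : series (exp_coeff a) @ \oo --> expR a by exact: is_cvg_series_exp_coeff.
    by rewrite -(cvg_shiftn 2) => h; under eq_fun do rewrite -addn2.
set W := (W in W @ \oo --> L).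
have -> : W = (fun n => S n.+2) \- (fun n => S n.+2 - W n).
  by apply/funext => n /=; rewrite opprB addrC subrK.
by rewrite -[L]subr0; apply: cvgB.
Unshelve. all: by end_near. Qed.

Lemma bnd_entry n (A : 'M[C]_n) a i j : bnd A a ->
  `|complex.Re (A i j)| <= a /\ `|complex.Im (A i j)| <= a.
Proof.
move=> [a0 h]; have := h (delta_mx j 0); rewrite -colE.
have -> : vnorm2 (delta_mx j 0 : 'cV[C]_n) = 1.
  rewrite /vnorm2 (bigD1 j)//= mxE !eqxx /= expr1n expr0n addr0 big1 ?addr0// => k kj.
  by rewrite mxE (negbTE kj) /= expr0n addr0.
rewrite mulr1 => le.
have : complex.Re (A i j) ^+ 2 + complex.Im (A i j) ^+ 2 <= a ^+ 2.
  apply: le_trans le; rewrite /vnorm2 (bigD1 i)//= mxE lerDl sumr_ge0// => k _.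
  by rewrite addr_ge0 ?sqr_ge0.
move=> {}le; split; rewrite -(@ler_pXn2r _ 2) ?nnegrE// real_normK ?num_real//.
  by apply: le_trans le; rewrite lerDl sqr_ge0.
by apply: le_trans le; rewrite lerDr sqr_ge0.
Qed.

(** Split into real and imaginary parts because [expm] is defined by these two limits. *)
Definition cvgC (u : nat -> C) (l : C) : Prop :=
  (fun n => complex.Re (u n)) @ \oo --> complex.Re l /\
  (fun n => complex.Im (u n)) @ \oo --> complex.Im l.

Lemma cvgC_cst (c : C) : cvgC (fun=> c) c.
Proof. by split; apply: cvg_cst. Qed.

Lemma cvgCD u v (l m : C) : cvgC u l -> cvgC v m -> cvgC (fun n => u n + v n) (l + m).
Proof.
move=> [u1 u2] [v1 v2]; split.
  by rewrite ReD; under eq_fun do rewrite ReD; apply: cvgD.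
by rewrite ImD; under eq_fun do rewrite ImD; apply: cvgD.
Qed.

Lemma cvgCM u v (l m : C) : cvgC u l -> cvgC v m -> cvgC (fun n => u n * v n) (l * m).
Proof.
move=> [u1 u2] [v1 v2]; split.
  by rewrite ReM; under eq_fun do rewrite ReM; apply: cvgB; apply: cvgM.
by rewrite ImM; under eq_fun do rewrite ImM; apply: cvgD; apply: cvgM.
Qed.

Lemma cvgC_sum (I : finType) (u : I -> nat -> C) (l : I -> C) :
  (forall i, cvgC (u i) (l i)) -> cvgC (fun n => \sum_i u i n) (\sum_i l i).
Proof.
move=> h; elim: (index_enum I) => [|i r ih].
  by rewrite big_nil; under eq_fun do rewrite big_nil; exact: cvgC_cst.
by rewrite big_cons; under eq_fun do rewrite big_cons; exact: cvgCD.
Qed.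

Definition cvgmx n (A_ : nat -> 'M[C]_n) (A : 'M[C]_n) : Prop :=
  forall i j, cvgC (fun k => A_ k i j) (A i j).

Lemma cvgmx_cst n (A : 'M[C]_n) : cvgmx (fun=> A) A.
Proof. by move=> i j; apply: cvgC_cst. Qed.

Lemma cvgmxM n A_ B_ (A B : 'M[C]_n) : cvgmx A_ A -> cvgmx B_ B ->
  cvgmx (fun k => A_ k *m B_ k) (A *m B).
Proof.
move=> hA hB i j; rewrite mxE; under eq_fun do rewrite mxE.
by apply: cvgC_sum => k; apply: cvgCM.
Qed.

Lemma cvgC_tr n A_ (A : 'M[C]_n) : cvgmx A_ A -> cvgC (fun k => \tr (A_ k)) (\tr A).
Proof. by move=> hA; apply: cvgC_sum. Qed.

Lemma mxpowE n (A : 'M[C]_n) k : mxpow A k = A ^+ k.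
Proof. by elim: k => [|k ih]; rewrite ?expr0// exprS /= ih. Qed.

Lemma exprZmx n (c : C) (A : 'M[C]_n) k : (c *: A) ^+ k = c ^+ k *: A ^+ k.
Proof.
elim: k => [|k ih]; first by rewrite !expr0 scale1r.
by rewrite !exprS ih -[LHS]scalemxAl -scalemxAr scalerA.
Qed.

(** By the binomial theorem each entry is the sum treated in [cvg_binomial_exp_series], the entries
    of A^k being dominated by a^k. Every later fact about [expm] passes through this limit. *)
Lemma expm_cvg n (A : 'M[C]_n) :
  cvgmx (fun k => (1%:M + (k.+1%:R^-1 +i* 0) *: A) ^+ k.+1) (expm A).
Proof.
move=> i j; have [a ha] := bnd_exists A; have a0 := bnd_ge0 ha.
have hp k := bnd_entry i j (bndX k ha).
have bE (k : nat) : (1%:M + (k.+1%:R^-1 +i* 0) *: A) ^+ k.+1 =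
   \sum_(l < k.+2) ((k.+1%:R^-1 ^+ l *+ 'C(k.+1, l)) +i* 0) *: A ^+ l.
  rewrite addrC exprD1n; apply: eq_bigr => l _.
  rewrite exprZmx scalerMnl; congr (_ *: _).
  rewrite -[k.+1%:R^-1 +i* 0]/((k.+1%:R^-1)%:C) -[RHS]/((_ *+ _)%:C).
  by rewrite -(rmorphXn (real_complex R)) -(raddfMn (real_complex R)).
rewrite /expm mxE; split => /=.
  have [_ +] := cvg_binomial_exp_series a0 (fun k => (hp k).1).
  have -> : (fun K => complex.Re (expm_partial A K i j)) =
      (fun K => \sum_(k < K) k`!%:R^-1 * complex.Re ((A ^+ k) i j)).
    apply/funext => K; rewrite /expm_partial summxE Re_sum; apply: eq_bigr => k _.
    rewrite mxE mxpowE -(rmorph_nat (real_complex R)) -fmorphV.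
    by case: (_ i j) => x y /=; rewrite mul0r subr0.
  set f := fun n => _.
  have -> // : (fun k => complex.Re (((1%:M + (k.+1%:R^-1 +i* 0) *: A) ^+ k.+1) i j)) = f.
  apply/funext => k.
  rewrite bE summxE Re_sum; apply: eq_bigr => l _.
  by rewrite mxE ReM /= mul0r subr0.
have [_ +] := cvg_binomial_exp_series a0 (fun k => (hp k).2).
have -> : (fun K => complex.Im (expm_partial A K i j)) =
    (fun K => \sum_(k < K) k`!%:R^-1 * complex.Im ((A ^+ k) i j)).
  apply/funext => K; rewrite /expm_partial summxE Im_sum; apply: eq_bigr => k _.
  rewrite mxE mxpowE -(rmorph_nat (real_complex R)) -fmorphV.
  by case: (_ i j) => x y /=; rewrite mul0r addr0.
set f := fun n => _.
have -> // : (fun k => complex.Im (((1%:M + (k.+1%:R^-1 +i* 0) *: A) ^+ k.+1) i j)) = f.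
apply/funext => k.
rewrite bE summxE Im_sum; apply: eq_bigr => l _.
by rewrite mxE ImM /= mul0r addr0.
Qed.

End ExponentialLimit.

(** * Traces against a density matrix *)

Section TraceBound.
Variable R : realType.
Local Notation C := R[i].

Local Open Scope sesquilinear_scope.

Lemma conj_conjc (z : C) : Num.conj z = z^*.
Proof. by []. Qed.

(** Weighted arithmetic-geometric mean: |Re <u, w>| <= (k |u|^2 + |w|^2 / k) / 2 with w = X u, where
    |u| = 1 and |w| <= k. *)
Lemma Re_form_le n (X : 'M[C]_n) k (u : 'cV[C]_n) : bnd X k -> vnorm2 u = 1 ->
  `|complex.Re (\sum_i (u i 0)^* * (X *m u) i 0)| <= k.
Proof.
move=> [k0 hX] u1; have := hX u; rewrite u1 mulr1; set w := X *m u => wk.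
move: k0; rewrite le_eqVlt => /orP[/eqP k0|k0].
  have w0 : w = 0.
    by apply/vnorm2_eq0/eqP; rewrite eq_le vnorm2_ge0 (le_trans wk)// -k0 expr0n.
  by rewrite w0 big1 ?normr0 -?k0// => i _; rewrite mxE mulr0.
apply: (@le_trans _ _ ((k * vnorm2 u + k^-1 * vnorm2 w) / 2)); last first.
  rewrite u1 mulr1 ler_pdivrMr// mulr_natr mulr2n lerD2l.
  by rewrite ler_pdivrMl// -expr2.
rewrite Re_sum; apply: le_trans (ler_norm_sum _ _ _) _.
rewrite /vnorm2 !mulr_sumr -big_split /= mulr_suml; apply: ler_sum => i _.
case: (u i 0) (w i 0) => [a b] [x y] /=.
(* The sign s = 1 or -1 handles both sides of the absolute value; the term in 1 - s^2 makes the
   completed square a polynomial identity in s. *)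
have am (s : R) : s ^+ 2 = 1 ->
  s * (a * x - - b * y) <= (k * (a ^+ 2 + b ^+ 2) + k^-1 * (x ^+ 2 + y ^+ 2)) / 2.
  move=> s2; rewrite -subr_ge0.
  have -> : (k * (a ^+ 2 + b ^+ 2) + k^-1 * (x ^+ 2 + y ^+ 2)) / 2
     - s * (a * x - - b * y) =
     k / 2 * ((a - s * k^-1 * x) ^+ 2 + (b - s * k^-1 * y) ^+ 2)
     + (1 - s ^+ 2) * (k^-1 * (x ^+ 2 + y ^+ 2) / 2) by field; rewrite gt_eqF.
  by rewrite s2 subrr mul0r addr0 mulr_ge0 ?addr_ge0 ?sqr_ge0// divr_ge0// ltW.
rewrite ler_norml; have := am 1; have := am (-1).
by rewrite sqrrN !expr1n mulN1r mul1r => /(_ erefl) + /(_ erefl); lra.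
Qed.

(** In an eigenbasis u_l of rho, tr (rho X) is the average of the forms <u_l, X u_l> weighted by the
    eigenvalues, which are nonnegative by positivity and sum to 1 by the case X = 1. *)
Lemma density_trace_le n (rho X : 'M[C]_n) k : density_matrix rho -> bnd X k ->
  `|complex.Re (\tr (rho *m X))| <= k.
Proof.
move=> [hrho [prho trho]] hX.
have nrho : rho \is normalmx.
  apply/normalmxP; suff -> : rho ^t Num.conj = rho by [].
  by apply/matrixP => i j; rewrite !mxE (hrho i j) conj_conjc conjcK.
have /orthomx_spectralP := nrho.
set P := spectralmx rho; set d := spectral_diag rho => rE.
have uP : P \is unitarymx := spectral_unitarymx rho.
have iP : invmx P = P ^t Num.conj := invmx_unitary uP.
pose u k := col k (P ^t Num.conj).
have form (Y : 'M[C]_n) l : (P *m Y *m invmx P) l l = \sum_i (u l i 0)^* * (Y *m u l) i 0.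
  rewrite -mulmxA mxE; apply: eq_bigr => i _.
  rewrite /u iP !mxE conj_conjc conjcK; congr (_ * _).
  by apply: eq_bigr => j _; rewrite !mxE.
have u1 l : vnorm2 (u l) = 1.
  have := form 1%:M l; rewrite mulmx1 mulmxV ?spectral_unit// mxE eqxx mul1mx.
  move/(congr1 (@complex.Re R)); rewrite Re_sum mulr1n /= => e.
  rewrite [RHS]e; apply: eq_bigr => i _.
  by case: (u l i 0) => a b /=; ring.
have dE l : d 0 l = \sum_i (u l i 0)^* * (rho *m u l) i 0.
  rewrite -form {1}rE !mulmxA mulmxV ?spectral_unit// mul1mx.
  by rewrite mulmxK ?spectral_unit// mxE eqxx.
have d0 l : 0 <= complex.Re (d 0 l) /\ complex.Im (d 0 l) = 0.
  split; last by rewrite dE; exact: Im_hermitian_form.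
  rewrite dE; have := prho (u l); congr (0 <= complex.Re _); apply: eq_bigr => i _.
  by rewrite [(rho *m _) _ _]mxE mulr_sumr; apply: eq_bigr => j _; rewrite mulrA.
have trE (Y : 'M[C]_n) :
    \tr (rho *m Y) = \sum_l d 0 l * (\sum_i (u l i 0)^* * (Y *m u l) i 0).
  rewrite {1}rE -!mulmxA mxtrace_mulC -mulmxA -[P *m _ *m _]mulmxA.
  apply: eq_bigr => l _; rewrite mul_diag_mx mxE -form.
  by rewrite !mulmxA.
have sd : \sum_l complex.Re (d 0 l) = 1.
  have := congr1 (@complex.Re R) (trE 1%:M); rewrite mulmx1 trho Re_sum /= => e.
  rewrite [RHS]e.
  apply: eq_bigr => l _; have := form 1%:M l.
  by rewrite mulmx1 mulmxV ?spectral_unit// mxE eqxx => <-; rewrite mulr1.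
rewrite trE Re_sum; apply: le_trans (ler_norm_sum _ _ _) _.
rewrite -[k]mul1r -sd mulr_suml; apply: ler_sum => l _.
have [dl di] := d0 l.
rewrite ReM di mul0r subr0 normrM ger0_norm// ler_wpM2l//.
exact: Re_form_le.
Qed.

End TraceBound.

(** * Perturbation of the approximating powers *)

Section Perturbation.
Variable R : realType.
Local Notation C := R[i].

(* First-order term of [(P + E) ^+ j] in [E]. *)
Fixpoint dpow n (P E : 'M[C]_n) (j : nat) : 'M[C]_n :=
  if j is j'.+1 then E *m P ^+ j' + P *m dpow P E j' else 0.

Lemma dpowZ n (P E : 'M[C]_n) c j : dpow P (c *: E) j = c *: dpow P E j.
Proof.
elim: j => [|j ih] /=; first by rewrite scaler0.
by rewrite ih -scalemxAl -scalemxAr scalerDr.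
Qed.

Lemma exprDmxB n (P E : 'M[C]_n) j :
  (P + E) ^+ j.+1 - P ^+ j.+1 = E *m (P + E) ^+ j + P *m ((P + E) ^+ j - P ^+ j).
Proof.
by rewrite !exprS -![_ * _]/(_ *m _) mulmxDl mulmxBr addrCA addrA.
Qed.

Section Telescoping.
Variables (n : nat) (P E : 'M[C]_n) (p e : R).
Hypotheses (p1 : 1 <= p) (hP : bnd P p) (hQ : bnd (P + E) p) (hE : bnd E e).

Let p0 : 0 <= p. Proof. exact: le_trans p1. Qed.

Let e0 : 0 <= e. Proof. exact: bnd_ge0 hE. Qed.

Let step_le j : e * p ^+ j + p * (j%:R * p ^+ j * e) <= j.+1%:R * p ^+ j.+1 * e.
Proof.
have h : e * p ^+ j <= p * (p ^+ j * e).
  by rewrite [e * _]mulrC ler_peMl// mulr_ge0// exprn_ge0.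
rewrite exprS -natr1; apply: le_trans (lerD h (lexx _)) _.
by rewrite le_eqVlt; apply/orP; left; apply/eqP; ring.
Qed.

(** Each of the j places where E can stand contributes at most p^j e; the assumption 1 <= p absorbs
    the missing factor p. *)
Lemma bnd_exprDmxB j : bnd ((P + E) ^+ j - P ^+ j) (j%:R * p ^+ j * e).
Proof.
elim: j => [|j ih]; first by rewrite !expr0 subrr !mul0r; exact: bnd0.
rewrite exprDmxB; apply: bnd_le (step_le j) _.
by apply: bndD; apply: bndM => //; exact: bndX.
Qed.

Lemma bnd_dpow j : bnd (dpow P E j) (j%:R * p ^+ j * e).
Proof.
elim: j => [|j ih] /=; first by rewrite !mul0r; exact: bnd0.
apply: bnd_le (step_le j) _.
by apply: bndD; apply: bndM => //; exact: bndX.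
Qed.

(** The recursion puts E in front of a first-order difference, which costs j p^j e^2 at each stage;
    j^2 p^j e^2 absorbs the sum of these costs. *)
Lemma bnd_exprDmx_remainder j :
  bnd ((P + E) ^+ j - P ^+ j - dpow P E j) (j%:R ^+ 2 * p ^+ j * e ^+ 2).
Proof.
elim: j => [|j ih] /=.
  by rewrite !expr0 subrr subr0 expr0n !mul0r; exact: bnd0.
have -> : (P + E) ^+ j.+1 - P ^+ j.+1 - (E *m P ^+ j + P *m dpow P E j) =
    E *m ((P + E) ^+ j - P ^+ j) + P *m ((P + E) ^+ j - P ^+ j - dpow P E j).
  rewrite exprDmxB [E *m (_ - _)]mulmxBr [P *m (_ - dpow _ _ _)]mulmxBr.
  by rewrite opprD addrACA.
apply: bnd_le; last first.
  by apply: bndD; apply: bndM; [exact: hE|exact: bnd_exprDmxB|exact: hP|exact: ih].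
have q0 : 0 <= p ^+ j * e ^+ 2 by rewrite mulr_ge0 ?exprn_ge0.
have -> : e * (j%:R * p ^+ j * e) + p * (j%:R ^+ 2 * p ^+ j * e ^+ 2)
  = (j%:R + p * j%:R ^+ 2) * (p ^+ j * e ^+ 2) by ring.
have -> : j.+1%:R ^+ 2 * p ^+ j.+1 * e ^+ 2 = (j.+1%:R ^+ 2 * p) * (p ^+ j * e ^+ 2).
  by rewrite (exprS p); ring.
rewrite ler_wpM2r// -natr1.
have j0 : (0 : R) <= j%:R by [].
have : 0 <= j%:R * (p - 1) by rewrite mulr_ge0 ?subr_ge0.
have jp0 : 0 <= j%:R * p by rewrite mulr_ge0.
move=> jp1; rewrite -subr_ge0.
have -> : (j%:R + 1) ^+ 2 * p - (j%:R + p * j%:R ^+ 2) = j%:R * (p - 1) + j%:R * p + p.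
  by ring.
by rewrite !addr_ge0.
Qed.

End Telescoping.

Lemma expR_sqr_ge1 (x : R) : 1 <= expR (x ^+ 2 / 2).
Proof. by rewrite -expR0 ler_expR divr_ge0// sqr_ge0. Qed.

(** The approximant of exp(i s K) with m+1 factors, so that the step s / (m+1) is always defined. *)
Definition expm_step n (s : R) (m : nat) (K : 'M[C]_n) : 'M[C]_n :=
  (1%:M + (0 +i* (s / m.+1%:R)) *: K) ^+ m.+1.

Lemma expm_step_cvg n s (K : 'M[C]_n) :
  cvgmx (fun m => expm_step s m K) (expm ((0 +i* s) *: K)).
Proof.
have -> : (fun m => expm_step s m K) =
    (fun k => (1%:M + (k.+1%:R^-1 +i* 0) *: ((0 +i* s) *: K)) ^+ k.+1).
  apply/funext => m; rewrite /expm_step scalerA.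
  have -> // : (m.+1%:R^-1 +i* 0) * (0 +i* s) = 0 +i* (s / m.+1%:R) :> C.
  by apply/eqP; rewrite eq_complex /= !(mul0r, mulr0) subr0 addr0 eqxx mulrC eqxx.
exact: expm_cvg.
Qed.

(** The m+1 bounds of [bnd_1iK] multiplied together. It depends on k but tends to 1, which is how
    the size of K leaves the final estimates. *)
Definition step_err (s k : R) (m : nat) : R := expR ((s * k) ^+ 2 / 2 / m.+1%:R).

Lemma step_err_cvg s k : step_err s k m @[m --> \oo] --> (1 : R).
Proof.
have -> : 1 = expR ((s * k) ^+ 2 / 2 * 0) by rewrite mulr0 expR0.
rewrite /step_err; have h : ((fun m => (s * k) ^+ 2 / 2 * m.+1%:R^-1) : R^nat) @ \oo -->
    ((s * k) ^+ 2 / 2 * 0 : R).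
  by apply: cvgMr; exact: cvg_invSn.
by apply: (cvg_comp _ _ h); exact: continuous_expR.
Qed.

Lemma step_err_powE (s k : R) m :
  expR ((s / m.+1%:R * k) ^+ 2 / 2) ^+ m.+1 = step_err s k m.
Proof.
rewrite /step_err -expRM_natl; congr expR.
have : (m.+1%:R : R) != 0 by rewrite pnatr_eq0.
by move: (m.+1%:R : R) => N N0; field.
Qed.

Lemma bnd_expm_step n s m (K : 'M[C]_n) k : hermitian_mx K -> bnd K k ->
  bnd (expm_step s m K) (step_err s k m).
Proof.
by move=> hK bK; rewrite -step_err_powE; apply/bndX/bnd_1iK.
Qed.

(** The derivative of the approximant at K in direction V, a discrete Duhamel integral. *)
Definition dexpm_step n (s : R) (m : nat) (K V : 'M[C]_n) : 'M[C]_n :=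
  dpow (1%:M + (0 +i* (s / m.+1%:R)) *: K) ((0 +i* (s / m.+1%:R)) *: V) m.+1.

Lemma hermitian_line n (K V : 'M[C]_n) x : hermitian_mx K -> hermitian_mx V ->
  hermitian_mx (K + (x +i* 0) *: V).
Proof.
move=> hK hV i j; rewrite !mxE (hK i j) (hV i j) rmorphD rmorphM /=.
by rewrite oppr0.
Qed.

Lemma bnd_line n (K V : 'M[C]_n) x k : bnd K k -> bnd V 1 ->
  bnd (K + (x +i* 0) *: V) (k + `|x|).
Proof.
by move=> bK bV; apply: bndD => //; rewrite -normc_real -[X in bnd _ X]mulr1; apply: bndZ.
Qed.

Section ExpmStepLine.
Variables (n : nat) (K V : 'M[C]_n) (s x k : R) (m : nat).
Hypotheses (hK : hermitian_mx K) (hV : hermitian_mx V).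
Hypotheses (bK : bnd K k) (bV : bnd V 1).
Let Kx := K + (x +i* 0) *: V.
Let z := s / m.+1%:R.
Let P := 1%:M + (0 +i* z) *: K.
Let E := (x +i* 0) *: ((0 +i* z) *: V).
Let kx := k + `|x|.
Let p := expR ((z * kx) ^+ 2 / 2).

Let PE : 1%:M + (0 +i* z) *: Kx = P + E.
Proof.
by rewrite /P /E /Kx scalerDr addrA !scalerA [(x +i* 0) * _]mulrC.
Qed.

Let p1 : 1 <= p.
Proof. exact: expR_sqr_ge1. Qed.

Let bP : bnd P p.
Proof.
apply: bnd_1iK; first exact: hK.
by apply: (bnd_le _ bK); rewrite lerDl.
Qed.

Let bQ : bnd (P + E) p.
Proof.
by rewrite -PE; apply: bnd_1iK; [exact: hermitian_line|exact: bnd_line].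
Qed.

Let bV' : bnd ((0 +i* z) *: V) (`|s| / m.+1%:R).
Proof.
have := bndZ (0 +i* z) bV; rewrite normc_imag mulr1 normrM normfV.
by rewrite (ger0_norm (ler0n _ _)).
Qed.

Let bE : bnd E (`|x| * (`|s| / m.+1%:R)).
Proof. by rewrite -normc_real; apply: bndZ. Qed.

Let n0 : (m.+1%:R : R) != 0. Proof. by rewrite pnatr_eq0. Qed.

(** The m+1 places for the perturbation cancel the denominator of its size |x| |s| / (m+1). The
    radius k + |x| serves for K and for K + x V alike. *)
Lemma bnd_expm_stepB :
  bnd (expm_step s m Kx - expm_step s m K) (step_err s kx m * (`|x| * `|s|)).
Proof.
have := bnd_exprDmxB p1 bP bQ bE m.+1.
have -> : m.+1%:R * p ^+ m.+1 * (`|x| * (`|s| / m.+1%:R)) =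
    p ^+ m.+1 * (`|x| * `|s|).
  by move: (p ^+ _) (m.+1%:R) n0 => q N N0; field.
by rewrite -PE step_err_powE.
Qed.

Lemma bnd_expm_step_remainder :
  bnd (expm_step s m Kx - expm_step s m K - (x +i* 0) *: dexpm_step s m K V)
    (step_err s kx m * (x ^+ 2 * s ^+ 2)).
Proof.
have := bnd_exprDmx_remainder p1 bP bQ bE m.+1.
have -> : m.+1%:R ^+ 2 * p ^+ m.+1 * (`|x| * (`|s| / m.+1%:R)) ^+ 2 =
    p ^+ m.+1 * (x ^+ 2 * s ^+ 2).
  rewrite -(real_normK (num_real x)) -(real_normK (num_real s)).
  by move: (p ^+ _) (m.+1%:R) n0 => q N N0; field.
by rewrite -PE step_err_powE dpowZ.
Qed.

End ExpmStepLine.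

Lemma bnd_dexpm_step n (K V : 'M[C]_n) (s k : R) m :
  hermitian_mx K -> bnd K k -> bnd V 1 ->
  bnd (dexpm_step s m K V) (step_err s k m * `|s|).
Proof.
move=> hK bK bV; have k0 := bnd_ge0 bK.
have z0 : Normc.normc ((0 +i* (s / m.+1%:R)) : C) = `|s| / m.+1%:R.
  by rewrite normc_imag normrM normfV (ger0_norm (ler0n _ _)).
set p := expR ((s / m.+1%:R * k) ^+ 2 / 2).
have bE : bnd ((0 +i* (s / m.+1%:R)) *: V) (`|s| / m.+1%:R).
  by have := bndZ (0 +i* (s / m.+1%:R)) bV; rewrite z0 mulr1.
have bP : bnd (1%:M + (0 +i* (s / m.+1%:R)) *: K) p.
  exact: bnd_1iK.
have p1 : 1 <= p by exact: expR_sqr_ge1.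
have := bnd_dpow p1 bP bE m.+1.
have -> : m.+1%:R * p ^+ m.+1 * (`|s| / m.+1%:R) = p ^+ m.+1 * `|s|.
  have : (m.+1%:R : R) != 0 by rewrite pnatr_eq0.
  by move: (p ^+ _) (m.+1%:R) => q N N0; field.
by rewrite step_err_powE.
Qed.

End Perturbation.

(** * Heisenberg expectations along a line *)

Section HeisenbergLine.
Variable R : realType.
Local Notation C := R[i].
Local Opaque expm_step dexpm_step.

Definition heis_step n (rho K O : 'M[C]_n) (t : R) (m : nat) : C :=
  \tr (rho *m expm_step t m K *m O *m expm_step (- t) m K).

Lemma heis_stepE n (rho K O : 'M[C]_n) t m : heis_step rho K O t m =
  \tr (rho *m (expm_step t m K *m O *m expm_step (- t) m K)).
Proof. by rewrite !mulmxA. Qed.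

Lemma heis_step_cvg n (rho K O : 'M[C]_n) t :
  cvgC (heis_step rho K O t) (heis_expect rho K O t).
Proof.
apply: cvgC_tr; apply: cvgmxM; last exact: expm_step_cvg.
apply: cvgmxM; last exact: cvgmx_cst.
by apply: cvgmxM; [exact: cvgmx_cst|exact: expm_step_cvg].
Qed.

Lemma step_errN (s k : R) m : step_err (- s) k m = step_err s k m.
Proof. by rewrite /step_err mulNr sqrrN. Qed.

Lemma step_err_le (s k k' : R) m : 0 <= k -> k <= k' -> step_err s k m <= step_err s k' m.
Proof.
move=> k0 kk'; rewrite ler_expR ler_wpM2r ?invr_ge0// ler_wpM2r ?invr_ge0//.
by rewrite !exprMn ler_wpM2l ?sqr_ge0// lerXn2r ?nnegrE ?(le_trans k0).
Qed.

Lemma step_err_ub (s k : R) m : step_err s k m <= expR ((s * k) ^+ 2 / 2).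
Proof.
have : 0 <= (s * k) ^+ 2 / 2 by rewrite divr_ge0// sqr_ge0.
rewrite /step_err ler_expR; move: (_ / 2) => y y0.
by rewrite ler_pdivrMr ?ltr0n// ler_peMr// ler1n.
Qed.

(** Leibniz rule for the derivative of the approximate expectation at K in direction V. *)
Definition dheis_step n (rho K O V : 'M[C]_n) (t : R) (m : nat) : R :=
  complex.Re (\tr (rho *m (dexpm_step t m K V *m O *m expm_step (- t) m K +
    expm_step t m K *m O *m dexpm_step (- t) m K V))).

Lemma sandwichB n (A A' O B B' : 'M[C]_n) :
  A' *m O *m B' - A *m O *m B = (A' - A) *m O *m B' + A *m O *m (B' - B).
Proof. by rewrite !mulmxBl mulmxBr addrA subrK. Qed.

(** Two remainders, one for each outer factor, and a cross term of first-order quantities: three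
    contributions of the same size, whence the constant 3 of the second-order bounds. *)
Lemma sandwich_remainder n (c : C) (A A' O B B' dA dB : 'M[C]_n) :
  A' *m O *m B' - A *m O *m B - c *: (dA *m O *m B + A *m O *m dB) =
  (A' - A - c *: dA) *m O *m B' + A *m O *m (B' - B - c *: dB)
  + (c *: dA) *m O *m (B' - B).
Proof.
rewrite !(mulmxBl, mulmxBr) -!scalemxAl -!scalemxAr -!mulmxA scalerDr.
move: (A' *m _) (A *m (O *m B)) (c *: (dA *m (O *m B))) (A *m (O *m B'))
  (c *: (A *m _)) (c *: (dA *m (O *m B'))) => X1 X2 X3 X4 X5 X6.
by apply/matrixP => i j; rewrite !mxE; ring.
Qed.

Lemma mxtraceB n (A B : 'M[C]_n) : \tr (A - B) = \tr A - \tr B.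
Proof. by rewrite mxtraceD -scaleN1r mxtraceZ mulN1r. Qed.

Lemma Re_trace_combination n (rho A B D : 'M[C]_n) (x : R) :
  complex.Re (\tr (rho *m A)) - complex.Re (\tr (rho *m B))
    - x * complex.Re (\tr (rho *m D)) =
  complex.Re (\tr (rho *m (A - B - (x +i* 0) *: D))).
Proof. by rewrite !mulmxBr -scalemxAr !mxtraceB mxtraceZ !ReB ReM /= mul0r subr0. Qed.

Lemma Re_heis_step_le n (rho K O : 'M[C]_n) (t k w : R) m :
  density_matrix rho -> hermitian_mx K -> bnd K k -> bnd O w ->
  `|complex.Re (heis_step rho K O t m)| <= step_err t k m ^+ 2 * w.
Proof.
move=> hrho hK bK bO; rewrite heis_stepE; apply: density_trace_le => //.
have -> : step_err t k m ^+ 2 * w = step_err t k m * w * step_err t k m by ring.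
apply: bndM; last by rewrite -step_errN; exact: bnd_expm_step.
by apply: bndM => //; exact: bnd_expm_step.
Qed.

Section Steps.
Variables (n : nat) (rho K O V : 'M[C]_n) (t k w x : R) (m : nat).
Hypotheses (hrho : density_matrix rho) (hK : hermitian_mx K) (hV : hermitian_mx V).
Hypotheses (bK : bnd K k) (bV : bnd V 1) (bO : bnd O w) (t0 : 0 <= t).
Let Kx := K + (x +i* 0) *: V.
Let c := step_err t (k + `|x|) m.

Let bAx : bnd (expm_step t m Kx) c.
Proof. by apply: bnd_expm_step; [exact: hermitian_line|exact: bnd_line]. Qed.

Let bBx : bnd (expm_step (- t) m Kx) c.
Proof.
by rewrite /c -step_errN; apply: bnd_expm_step; [exact: hermitian_line|exact: bnd_line].
Qed.

Let le_c : step_err t k m <= c.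
Proof. by apply: step_err_le; [exact: bnd_ge0 bK|rewrite lerDl]. Qed.

Let bA : bnd (expm_step t m K) c.
Proof. by apply: bnd_le le_c _; apply: bnd_expm_step. Qed.

Let bB : bnd (expm_step (- t) m K) c.
Proof. by apply: bnd_le le_c _; rewrite -step_errN; apply: bnd_expm_step. Qed.

Let bdA : bnd (dexpm_step t m K V) (c * t).
Proof.
have := bnd_dexpm_step t m hK bK bV; rewrite ger0_norm//; apply: bnd_le.
by rewrite ler_wpM2r.
Qed.

Let bdB : bnd (dexpm_step (- t) m K V) (c * t).
Proof.
have h := bnd_dexpm_step (- t) m hK bK bV.
rewrite normrN (ger0_norm t0) (step_errN t k m) in h.
by apply: bnd_le h; rewrite ler_wpM2r.
Qed.

Let bAB : bnd (expm_step t m Kx - expm_step t m K) (c * (`|x| * t)).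
Proof.
by have := bnd_expm_stepB t x m hK hV bK bV; rewrite (ger0_norm t0).
Qed.

Let bBB : bnd (expm_step (- t) m Kx - expm_step (- t) m K) (c * (`|x| * t)).
Proof.
by have := bnd_expm_stepB (- t) x m hK hV bK bV; rewrite normrN (ger0_norm t0) step_errN.
Qed.

Let bRA : bnd (expm_step t m Kx - expm_step t m K - (x +i* 0) *: dexpm_step t m K V)
  (c * (x ^+ 2 * t ^+ 2)).
Proof. exact: bnd_expm_step_remainder. Qed.

Let bRB : bnd (expm_step (- t) m Kx - expm_step (- t) m K
  - (x +i* 0) *: dexpm_step (- t) m K V) (c * (x ^+ 2 * t ^+ 2)).
Proof.
by have := bnd_expm_step_remainder (- t) x m hK hV bK bV; rewrite step_errN sqrrN.
Qed.

Lemma Re_heis_stepB_le :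
  `|complex.Re (heis_step rho Kx O t m) - complex.Re (heis_step rho K O t m)|
  <= c ^+ 2 * (2 * w * t * `|x|).
Proof.
rewrite -ReB !heis_stepE -mxtraceB -mulmxBr sandwichB; apply: density_trace_le => //.
have -> : c ^+ 2 * (2 * w * t * `|x|) =
    (c * (`|x| * t)) * w * c + c * w * (c * (`|x| * t)) by ring.
by apply: bndD; do 2! apply: bndM => //.
Qed.

Lemma Re_heis_step_remainder_le :
  `|complex.Re (heis_step rho Kx O t m) - complex.Re (heis_step rho K O t m)
    - x * dheis_step rho K O V t m| <= c ^+ 2 * (3 * w * t ^+ 2 * x ^+ 2).
Proof.
have -> : complex.Re (heis_step rho Kx O t m) - complex.Re (heis_step rho K O t m)
    - x * dheis_step rho K O V t m = complex.Re (\tr (rho *m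
    (expm_step t m Kx *m O *m expm_step (- t) m Kx
     - expm_step t m K *m O *m expm_step (- t) m K
     - (x +i* 0) *: (dexpm_step t m K V *m O *m expm_step (- t) m K +
        expm_step t m K *m O *m dexpm_step (- t) m K V)))).
  by rewrite !heis_stepE; exact: Re_trace_combination.
rewrite sandwich_remainder.
apply: density_trace_le => //.
have -> : c ^+ 2 * (3 * w * t ^+ 2 * x ^+ 2) =
    (c * (x ^+ 2 * t ^+ 2)) * w * c + c * w * (c * (x ^+ 2 * t ^+ 2))
    + (`|x| * (c * t)) * w * (c * (`|x| * t)).
  by rewrite -(real_normK (num_real x)); ring.
apply: bndD; first by apply: bndD; do 2! apply: bndM => //.
by do 2! apply: bndM => //; rewrite -normc_real; apply: bndZ.
Qed.

Lemma dheis_step_le : `|dheis_step rho K O V t m| <= c ^+ 2 * (2 * w * t).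
Proof.
apply: density_trace_le => //.
have -> : c ^+ 2 * (2 * w * t) = (c * t) * w * c + c * w * (c * t) by ring.
by apply: bndD; do 2! apply: bndM => //.
Qed.

End Steps.

Lemma cvg_norm_le (u v : R^nat) (a b : R) : u @ \oo --> a -> v @ \oo --> b ->
  (forall m, `|u m| <= v m) -> `|a| <= b.
Proof.
move=> ua vb uv; have na : (fun m => `|u m|) @ \oo --> `|a| by exact: cvg_norm.
by apply: (@ler_cvg_to _ _ _ R _ _ _ _ na vb); near=> m; exact: uv.
Unshelve. all: by end_near. Qed.

(** A cluster point in the compact interval [-L, L], phrased so that closeness to it can be combined
    with any condition that holds eventually. *)
Lemma bounded_seq_cluster (u : R^nat) (L : R) : (forall m, `|u m| <= L) ->
  exists d : R, forall (e : R) (Q : nat -> Prop), 0 < e ->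
    (\forall m \near \oo, Q m) -> exists m, Q m /\ `|d - u m| < e.
Proof.
move=> uL; have uI : (u @ \oo) `[- L, L]%classic.
  by exists 0%N => // m _; rewrite /= in_itv /= -ler_norml.
have [d [_ cd]] := @segment_compact R (- L) L (u @ \oo) _ uI.
exists d => e Q e0 oQ.
have QA : (u @ \oo) (u @` Q) by apply: filterS oQ => m Qm; exists m.
have [_ [[m Qm <-] db]] := cd _ _ QA (nbhsx_ballx d e e0).
by exists m.
Qed.

Lemma norm_approx_le (F F0 Fm F0m pm l B Bm e e' : R) :
  `|Fm - F0m - pm| <= Bm -> `|F - Fm| < e' -> `|F0 - F0m| < e' -> `|B - Bm| < e' ->
  `|pm - l| <= e -> `|F - F0 - l| <= B + (e + 3 * e').
Proof.
rewrite !ler_norml !ltr_norml => /andP[? ?] /andP[? ?] /andP[? ?] /andP[? ?] /andP[? ?].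
by apply/andP; split; lra.
Qed.

Section Limits.
Variables (n : nat) (rho K O V : 'M[C]_n) (t w : R).
Hypotheses (hrho : density_matrix rho) (hK : hermitian_mx K) (hV : hermitian_mx V).
Hypotheses (bV : bnd V 1) (bO : bnd O w) (t0 : 0 <= t).
Let Kx x := K + (x +i* 0) *: V.
Let f x := complex.Re (heis_expect rho (Kx x) O t).

Let Kx0 : Kx 0 = K.
Proof. by rewrite /Kx -[0 +i* 0]/(0 : C) scale0r addr0. Qed.

Let fcvg x : (fun m => complex.Re (heis_step rho (Kx x) O t m)) @ \oo --> f x.
Proof. by have [] := heis_step_cvg rho (Kx x) O t. Qed.

Let err_cvg k (y : R) : (fun m => step_err t k m ^+ 2 * y) @ \oo --> y.
Proof.
have h : ((fun m => step_err t k m * step_err t k m * y) : R^nat) @ \oo --> (1 * 1 * y : R).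
  by apply: cvgMl; apply: cvgM; exact: step_err_cvg.
by rewrite !mul1r in h; apply: cvg_trans h.
Qed.

Lemma Re_heis_expect_le : `|complex.Re (heis_expect rho K O t)| <= w.
Proof.
have [k bK] := bnd_exists K; have [c _] := heis_step_cvg rho K O t.
by apply: (cvg_norm_le c (@err_cvg k w)) => m; exact: Re_heis_step_le.
Qed.

Lemma Re_heis_expectB_le x : `|f x - f 0| <= 2 * w * t * `|x|.
Proof.
have [k bK] := bnd_exists K.
apply: (cvg_norm_le (cvgB (@fcvg x) (@fcvg 0)) (@err_cvg (k + `|x|) _)) => m.
by rewrite /= Kx0; exact: Re_heis_stepB_le.
Qed.

(* The first-order coefficients of the approximants are bounded; any cluster
   point serves as the derivative at 0. *)
Lemma Re_heis_expect_quadratic :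
  exists d : R, forall x, `|f x - f 0 - d * x| <= 3 * w * t ^+ 2 * x ^+ 2.
Proof.
have [k bK] := bnd_exists K.
pose psi m := dheis_step rho K O V t m.
pose L := expR ((t * k) ^+ 2 / 2) ^+ 2 * (2 * w * t).
have k0 := bnd_ge0 bK; have w0 := bnd_ge0 bO.
have psiL m : `|psi m| <= L.
  (* Taking x = 0 gives the radius k, independent of the displacement, so one slope d can be fixed
     before x. *)
  apply: le_trans (dheis_step_le 0 m hrho hK bK bV bO t0) _.
  have wt0 : 0 <= 2 * w * t by rewrite !mulr_ge0.
  apply: (ler_wpM2r wt0); rewrite normr0 addr0.
  apply: lerXn2r; rewrite ?nnegrE; [exact: expR_ge0|exact: expR_ge0|].
  exact: step_err_ub.
have [d hd] := bounded_seq_cluster psiL.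
exists d => x; apply/ler_addgt0Pr => e e0.
(* The slope costs e' |x|, and the limits of the two expectations and of the bound cost e' each. *)
pose e' := e / (`|x| + 3); have x3 : 0 < `|x| + 3 by rewrite ltr_wpDl.
have e'0 : 0 < e' by rewrite divr_gt0.
have ex p : `|d - p| < e' -> `|x * p - d * x| <= e' * `|x|.
  by rewrite distrC [x * p]mulrC -mulrBl normrM => /ltW; exact: ler_wpM2r.
have eE : e = e' * `|x| + 3 * e'.
  by rewrite [3 * _]mulrC -mulrDr divfK// gt_eqF.
set B := 3 * w * t ^+ 2 * x ^+ 2.
move/cvgrPdist_lt : (@fcvg x) => /(_ _ e'0) hx.
move/cvgrPdist_lt : (@fcvg 0) => /(_ _ e'0) h0.
move/cvgrPdist_lt : (@err_cvg (k + `|x|) B) => /(_ _ e'0) hB.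
have [m [[g1 [g2 g3]] gd]] := hd _ _ e'0 (filterI hx (filterI h0 hB)).
clear hx h0 hB fcvg err_cvg hd.
have main : `|complex.Re (heis_step rho (Kx x) O t m)
    - complex.Re (heis_step rho (Kx 0) O t m) - x * psi m|
    <= step_err t (k + `|x|) m ^+ 2 * B.
  by rewrite Kx0; exact: Re_heis_step_remainder_le.
rewrite eE; exact: (norm_approx_le main g1 g2 g3 (ex _ gd)).
Qed.


End Limits.

End HeisenbergLine.

(** * Reality of the expectations *)

Section HermitianTrace.
Variable R : realType.
Local Notation C := R[i].

Definition adjmx n (A : 'M[C]_n) : 'M[C]_n := \matrix_(i, j) (A j i)^*.

Lemma adjmx_hermitian n (A : 'M[C]_n) : hermitian_mx A -> adjmx A = A.
Proof. by move=> hA; apply/matrixP => i j; rewrite mxE (hA i j) conjcK. Qed.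

Lemma adjmxM n (A B : 'M[C]_n) : adjmx (A *m B) = adjmx B *m adjmx A.
Proof.
apply/matrixP => i j; rewrite !mxE rmorph_sum; apply: eq_bigr => k _.
by rewrite !mxE rmorphM mulrC.
Qed.

Lemma adjmxX n (A : 'M[C]_n) j : adjmx (A ^+ j) = adjmx A ^+ j.
Proof.
elim: j => [|j ih].
  by apply/matrixP => i k; rewrite !expr0 !mxE eq_sym rmorph_nat.
by rewrite exprSr exprS -ih; exact: (adjmxM (A ^+ j) A).
Qed.

Lemma adjmx_expm_step n s m (K : 'M[C]_n) : hermitian_mx K ->
  adjmx (expm_step s m K) = expm_step (- s) m K.
Proof.
move=> hK; rewrite /expm_step adjmxX; congr (_ ^+ _).
apply/matrixP => i j; rewrite !mxE (hK i j) rmorphD rmorphM rmorph_nat eq_sym.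
by rewrite mulNr /= conjcK.
Qed.

Lemma mxtrace_adj n (A : 'M[C]_n) : \tr (adjmx A) = (\tr A)^*.
Proof. by rewrite rmorph_sum; apply: eq_bigr => i _; rewrite mxE. Qed.

Lemma conj_trace_sandwich n (rho A O B : 'M[C]_n) : hermitian_mx rho -> hermitian_mx O ->
  adjmx A = B -> adjmx B = A -> (\tr (rho *m (A *m O *m B)))^* = \tr (rho *m (A *m O *m B)).
Proof.
move=> hr hO hA hB; rewrite -mxtrace_adj !adjmxM hA hB.
by rewrite (adjmx_hermitian hr) (adjmx_hermitian hO) mxtrace_mulC mulmxA.
Qed.

(** The adjoint swaps the approximants for t and -t, and cyclicity of the trace restores the order.
    Thus the complex modulus in the theorem becomes a real absolute value. *)
Lemma Im_heis_step n (rho K O : 'M[C]_n) t m :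
  hermitian_mx rho -> hermitian_mx K -> hermitian_mx O ->
  complex.Im (heis_step rho K O t m) = 0.
Proof.
move=> hr hK hO; have : (heis_step rho K O t m)^* = heis_step rho K O t m.
  have hA := adjmx_expm_step t m hK.
  have := adjmx_expm_step (- t) m hK; rewrite opprK => hB.
  by rewrite heis_stepE; exact: conj_trace_sandwich.
case: (heis_step _ _ _ _ _) => a b /= [] /eqP.
by rewrite eq_sym -addr_eq0 -mulr2n mulrn_eq0 /= => /eqP.
Qed.

Lemma Im_heis_expect n (rho K O : 'M[C]_n) t :
  hermitian_mx rho -> hermitian_mx K -> hermitian_mx O ->
  complex.Im (heis_expect rho K O t) = 0.
Proof.
move=> hr hK hO; have [_] := heis_step_cvg rho K O t.
have -> : (fun m => complex.Im (heis_step rho K O t m)) = (fun=> 0).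
  by apply/funext => m; exact: Im_heis_step.
move=> h; apply/esym; apply: (cvg_unique _ _ h) => //; exact: cvg_cst.
Qed.

End HermitianTrace.

(** * Measurability of the expectation *)

Section MeasurableExpectation.
Variable R : realType.
Local Notation C := R[i].
Context (d : measure_display) (T : measurableType d).

Definition measurableC (g : T -> C) : Prop :=
  measurable_fun setT (fun w => complex.Re (g w)) /\
  measurable_fun setT (fun w => complex.Im (g w)).

Lemma measurableC_cst c : measurableC (fun=> c).
Proof. by split; exact: measurable_cst. Qed.

Lemma measurableCD g h : measurableC g -> measurableC h -> measurableC (fun w => g w + h w).
Proof.
move=> [g1 g2] [h1 h2]; split.
  by under eq_fun do rewrite ReD; exact: measurable_funD.
by under eq_fun do rewrite ImD; exact: measurable_funD.
Qed.

Lemma measurableCM g h : measurableC g -> measurableC h -> measurableC (fun w => g w * h w).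
Proof.
move=> [g1 g2] [h1 h2]; split.
  by under eq_fun do rewrite ReM; apply: measurable_funB; exact: measurable_funM.
by under eq_fun do rewrite ImM; apply: measurable_funD; exact: measurable_funM.
Qed.

Lemma measurableC_sum (I : Type) (r : seq I) (g : I -> T -> C) :
  (forall i, measurableC (g i)) -> measurableC (fun w => \sum_(i <- r) g i w).
Proof.
move=> h; elim: r => [|i r ih].
  by under eq_fun do rewrite big_nil; exact: measurableC_cst.
by under eq_fun do rewrite big_cons; exact: measurableCD.
Qed.

Definition measurablemx n (A : T -> 'M[C]_n) : Prop :=
  forall i j, measurableC (fun w => A w i j).

Lemma measurablemx_cst n (A : 'M[C]_n) : measurablemx (fun=> A).
Proof. by move=> i j; exact: measurableC_cst. Qed.

Lemma measurablemxD n (A B : T -> 'M[C]_n) : measurablemx A -> measurablemx B ->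
  measurablemx (fun w => A w + B w).
Proof. by move=> hA hB i j; under eq_fun do rewrite mxE; exact: measurableCD. Qed.

Lemma measurablemxZ n (c : T -> C) (A : T -> 'M[C]_n) : measurableC c -> measurablemx A ->
  measurablemx (fun w => c w *: A w).
Proof. by move=> hc hA i j; under eq_fun do rewrite mxE; exact: measurableCM. Qed.

Lemma measurablemxM n (A B : T -> 'M[C]_n) : measurablemx A -> measurablemx B ->
  measurablemx (fun w => A w *m B w).
Proof.
move=> hA hB i j; under eq_fun do rewrite mxE.
by apply: measurableC_sum => k; exact: measurableCM.
Qed.

Lemma measurablemxX n (A : T -> 'M[C]_n) k : measurablemx A ->
  measurablemx (fun w => A w ^+ k).
Proof.
move=> hA; elim: k => [|k ih].
  by under eq_fun do rewrite expr0; exact: measurablemx_cst.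
by under eq_fun do rewrite exprS; exact: measurablemxM.
Qed.

Lemma measurablemx_sum n (I : Type) (r : seq I) (A : I -> T -> 'M[C]_n) :
  (forall i, measurablemx (A i)) -> measurablemx (fun w => \sum_(i <- r) A i w).
Proof.
move=> hA; elim: r => [|i r ih].
  by under eq_fun do rewrite big_nil; exact: measurablemx_cst.
by under eq_fun do rewrite big_cons; exact: measurablemxD.
Qed.

Lemma measurablemx_expm_step n s m (K : T -> 'M[C]_n) : measurablemx K ->
  measurablemx (fun w => expm_step s m (K w)).
Proof.
move=> hK; apply: measurablemxX; apply: measurablemxD; first exact: measurablemx_cst.
by apply: measurablemxZ => //; exact: measurableC_cst.
Qed.

(** A pointwise limit of polynomials in the entries of K. *)
Lemma measurable_Re_heis_expect n (rho O : 'M[C]_n) (K : T -> 'M[C]_n) t :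
  measurablemx K ->
  measurable_fun setT (fun w => complex.Re (heis_expect rho (K w) O t)).
Proof.
move=> hK.
apply: (@measurable_fun_cvg _ _ _ _ (fun m w => complex.Re (heis_step rho (K w) O t m))).
  move=> m; suff [] : measurableC (fun w => heis_step rho (K w) O t m) by [].
  apply: measurableC_sum => i.
  apply: (measurablemxM (B := fun w => expm_step (- t) m (K w))); last first.
    exact: measurablemx_expm_step.
  apply: measurablemxM; last exact: measurablemx_cst.
  by apply: measurablemxM; [exact: measurablemx_cst|exact: measurablemx_expm_step].
by move=> w _; have [] := heis_step_cvg rho (K w) O t.
Qed.

End MeasurableExpectation.

(** * The Hamiltonian as a function of the couplings *)

Section PerturbedHamiltonian.
Variable R : realType.
Local Notation C := R[i].
Variables (n M : nat) (H : 'M[C]_n) (V : 'I_M -> 'M[C]_n).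

Definition perturbed (x : 'I_M -> R) : 'M[C]_n := H + \sum_(k < M) (x k +i* 0) *: V k.

Definition upd (x : 'I_M -> R) (k : 'I_M) (y : R) : 'I_M -> R :=
  fun j => if j == k then y else x j.

(** Varying one coupling moves the Hamiltonian along a line in direction [V k], so the line
    estimates apply to coordinate slices. *)
Lemma perturbed_upd x k y :
  perturbed (upd x k y) = perturbed (upd x k 0) + (y +i* 0) *: V k.
Proof.
rewrite /perturbed -addrA; congr (_ + _).
rewrite (bigD1 k)//= [in RHS](bigD1 k)//= /upd eqxx -[0 +i* 0]/(0 : C) scale0r add0r.
rewrite addrC; congr (_ + _); apply: eq_bigr => j jk.
by rewrite (negbTE jk).
Qed.

Lemma hermitian_perturbed x : hermitian_mx H -> (forall k, hermitian_mx (V k)) ->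
  hermitian_mx (perturbed x).
Proof.
move=> hH hV i j; rewrite !mxE !summxE rmorphD rmorph_sum (hH i j); congr (_ + _).
apply: eq_bigr => k _; rewrite !mxE (hV k i j) rmorphM /= oppr0.
by [].
Qed.

Lemma perturbed0 : perturbed (fun=> 0) = H.
Proof.
rewrite /perturbed big1 ?addr0// => k _.
by rewrite -[0 +i* 0]/(0 : C) scale0r.
Qed.

Lemma measurablemx_perturbed d (T : measurableType d) (x : 'I_M -> T -> R) :
  (forall k, measurable_fun setT (x k)) ->
  measurablemx (fun w => perturbed (fun k => x k w)).
Proof.
move=> hx; apply: measurablemxD; first exact: measurablemx_cst.
apply: measurablemx_sum => k; apply: measurablemxZ; last exact: measurablemx_cst.
by split; [exact: hx|exact: measurable_cst].
Qed.

End PerturbedHamiltonian.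

(** * Gaussian and expectation facts *)

Section GaussianMGF.
Variable R : realType.

(** The Radon-Nikodym derivative of [normal_prob] equals [normal_pdf] almost everywhere, since both
    have the same integral on every measurable set. *)
Lemma integral_normal_prob (f : R -> R) : measurable_fun setT f -> (forall x, 0 <= f x) ->
  (\int[normal_prob 0 1]_x (f x)%:E =
   \int[lebesgue_measure]_x (f x * normal_pdf 0 1 x)%:E)%E.
Proof.
move=> mf f0.
have dom := normal_prob_dominates (0 : R) 1.
have mpdf : measurable_fun [set: R] (fun x => (normal_pdf 0 1 x)%:E).
  by apply/measurable_EFinP; exact: measurable_normal_pdf.
have mf' : measurable_fun [set: R] (fun x => (f x)%:E) by exact/measurable_EFinP.
have f0' x : (0 <= (f x)%:E)%E by rewrite lee_fin.
have cov := Radon_Nikodym_SigmaFinite.change_of_variables dom f0' measurableT mf'.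
apply: (etrans (esym cov)).
have ae : ae_eq lebesgue_measure setT
    (Radon_Nikodym_SigmaFinite.f (normal_prob (0 : R) 1) lebesgue_measure)
    (fun x => (normal_pdf 0 1 x)%:E).
  apply: integral_ae_eq => //; first exact: Radon_Nikodym_SigmaFinite.f_integrable.
  by move=> E _ mE; rewrite -Radon_Nikodym_SigmaFinite.f_integral.
have mRN := measurable_int _ (Radon_Nikodym_SigmaFinite.f_integrable dom).
apply: ae_eq_integral => //.
- by apply: emeasurable_funM => //; exact/measurable_EFinP.
- apply/measurable_EFinP; apply: measurable_funM => //; exact: measurable_normal_pdf.
by apply: filterS ae => x h _; rewrite /= EFinM h.
Qed.

(** Completing the square turns the integrand into exp(s^2 / 2) times the density of mean s. *)
Lemma normal_prob_mgf (s : R) :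
  (\int[normal_prob 0 1]_x (expR (s * x))%:E = (expR (s ^+ 2 / 2))%:E)%E.
Proof.
rewrite integral_normal_prob; last 2 first.
- by apply: measurableT_comp => //; exact: measurable_funM.
- by move=> x; exact: expR_ge0.
have E x : expR (s * x) * normal_pdf 0 1 x = expR (s ^+ 2 / 2) * normal_pdf s 1 x.
  rewrite !normal_pdfE ?oner_neq0//= /normal_fun !(mulrCA (expR _)) -!expRD.
  by congr (_ * expR _); field.
under eq_integral do rewrite E EFinM.
rewrite integralZl//; last exact: integrable_normal_pdf.
by rewrite integral_normal_pdf mule1.
Qed.

(* [normal_prob] lives on [measurableTypeR R], while the law of a random variable
   lives on [R] itself: same Borel sets, distinct measurable structures. *)
Lemma normal_prob_mgf_borel (s : R) :
  (@integral default_measure_display R R (normal_prob 0 1) setT (fun x => (expR (s * x))%:E)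
   = (expR (s ^+ 2 / 2))%:E)%E.
Proof.
rewrite -(normal_prob_mgf s).
have mid : @measurable_fun _ default_measure_display (measurableTypeR R) R setT id by [].
have mf : measurable_fun [set: R] (fun x => (expR (s * x))%:E).
  by apply/measurable_EFinP; apply: measurableT_comp => //; exact: measurable_funM.
have f0 : {in [set: R], forall y : R, (0 <= (expR (s * y))%:E)%E}.
  by move=> y _; rewrite lee_fin expR_ge0.
exact: (@ge0_integral_pushforward _ default_measure_display (measurableTypeR R) R R
  id mid (normal_prob 0 1) setT _ measurableT mf f0).
Qed.

End GaussianMGF.

Section RealExpectation.
Context (R : realType) (d : measure_display) (T : measurableType d).
Variable P : probability T R.
Implicit Types (X Y : T -> R) (a b c : R).

(** Integrability travels with the value, so the rules below carry no separate side conditions. *)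
Definition has_mean (X : T -> R) (a : R) : Prop :=
  P.-integrable setT (EFin \o X) /\ (\int[P]_w (X w)%:E = a%:E)%E.

Lemma has_mean_measurable X a : has_mean X a -> measurable_fun setT X.
Proof. by move=> [/measurable_int/measurable_EFinP]. Qed.

Lemma has_mean_cst a : has_mean (fun=> a) a.
Proof.
split; first exact: finite_measure_integrable_cst.
by rewrite integral_cst//= probability_setT mule1.
Qed.

Lemma has_meanD X Y a b : has_mean X a -> has_mean Y b ->
  has_mean (fun w => X w + Y w) (a + b).
Proof.
move=> [iX EX] [iY EY]; split; first exact: (integrableD measurableT iX iY).
under eq_integral do rewrite EFinD.
by rewrite (integralD measurableT iX iY) EX EY.
Qed.

Lemma has_meanZ X a c : has_mean X a -> has_mean (fun w => c * X w) (c * a).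
Proof.
move=> [iX EX]; split; first exact: (integrableZl measurableT c iX).
under eq_integral do rewrite EFinM.
by rewrite (integralZl measurableT iX) EX.
Qed.

Lemma has_mean_le X Y a b : has_mean X a -> has_mean Y b ->
  (forall w, X w <= Y w) -> a <= b.
Proof.
move=> [iX EX] [iY EY] XY; rewrite -lee_fin -EX -EY.
by apply: le_integral => // w _; rewrite lee_fin.
Qed.

Lemma has_mean_le_integrable X Y b : measurable_fun setT X -> has_mean Y b ->
  (forall w, `|X w| <= Y w) -> exists a, has_mean X a.
Proof.
move=> mX [iY _] XY.
have iX : P.-integrable setT (EFin \o X).
  apply: le_integrable iY => //; first exact/measurable_EFinP.
  by move=> w _ /=; rewrite lee_fin (le_trans (XY w))// ler_norm.
exists (fine (\int[P]_w (X w)%:E)); split => //.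
by rewrite fineK//; exact: integrable_fin_num.
Qed.

Lemma has_mean_bounded X c : measurable_fun setT X -> (forall w, `|X w| <= c) ->
  exists a, has_mean X a.
Proof. by move=> mX Xc; exact: has_mean_le_integrable (has_mean_cst c) Xc. Qed.

Definition independent_pair (X Y : T -> R) : Prop :=
  forall A B : set R, measurable A -> measurable B ->
  (P (X @^-1` A `&` Y @^-1` B) = P (X @^-1` A) * P (Y @^-1` B))%E.

(** Boundedness of X makes the product integrable. The joint law is the product of the marginals, as
    they agree on rectangles, and Fubini concludes. *)
Lemma has_meanM X Y c a b : independent_pair X Y -> (forall w, `|X w| <= c) ->
  has_mean X a -> has_mean Y b -> has_mean (fun w => X w * Y w) (a * b).
Proof.
move=> ind Xc hX hY.
have mX := has_mean_measurable hX; have mY := has_mean_measurable hY.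
have [iX EX] := hX; have [iY EY] := hY.
have iXY : P.-integrable setT (EFin \o (fun w => X w * Y w)).
  have iZ := integrableZl measurableT c iY.
  apply: le_integrable iZ => //; first exact/measurable_EFinP/measurable_funM.
  move=> w _ /=; rewrite lee_fin !normrM ler_wpM2r//.
  by rewrite (le_trans (Xc w))// ler_norm.
split => //.
pose X' : {mfun T >-> R} := mfun_Sub (mem_set mX).
pose Y' : {mfun T >-> R} := mfun_Sub (mem_set mY).
have mZ : measurable_fun setT (fun w => (X w, Y w)) by exact: measurable_fun_pair.
pose Z' : {mfun T >-> (R * R)%type} := mfun_Sub (mem_set mZ).
pose m1 : probability R R := distribution P X'.
pose m2 : probability R R := distribution P Y'.
pose m' : probability (R * R)%type R := distribution P Z'.
pose f (z : R * R) := (z.1 * z.2)%:E.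
have mf : measurable_fun setT f.
  by apply/measurable_EFinP; apply: measurable_funM.
have prodE S : measurable S -> (m1 \x m2)%E S = m' S.
  by apply: product_measure_unique => A B mA mB; exact: ind.
have if' : m'.-integrable setT f by exact: integrable_pushforward.
have ifp : (m1 \x m2)%E.-integrable setT f.
  apply/integrableP; split=> //.
  rewrite (eq_measure_integral m'); last by move=> A mA _; exact: prodE.
  by have /integrableP[] := if'.
transitivity (\int[m']_z f z)%E; first by rewrite integral_pushforward.
have <- : (\int[(m1 \x m2)%E]_z f z = \int[m']_z f z)%E.
  by apply: eq_measure_integral => A mA _; exact: prodE.
rewrite -(integral12_prod_meas1 ifp) /fubini_F.
have mE : measurable_fun [set: R] (fun y : R => y%:E) by exact/measurable_EFinP.
have EY' : (\int[m2]_y y%:E = b%:E)%E.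
  by rewrite -EY; exact: (integral_distribution (X := Y') mE iY).
have EX' : (\int[m1]_y y%:E = a%:E)%E.
  by rewrite -EX; exact: (integral_distribution (X := X') mE iX).
have iY' : m2.-integrable setT (fun y : R => y%:E) by exact: integrable_pushforward.
have iX' : m1.-integrable setT (fun y : R => y%:E) by exact: integrable_pushforward.
under eq_integral do rewrite /f /=; under eq_integral do under eq_integral do rewrite EFinM.
under eq_integral do rewrite (integralZl measurableT iY') EY'.
rewrite (integralZr measurableT iX').
by rewrite EX' EFinM.
Qed.

End RealExpectation.

(** * Independence from the past *)

Section Past.
Context (R : realType) (d : measure_display) (T : measurableType d).
Variables (P : probability T R) (M : nat) (theta : 'I_M -> {RV P >-> R}).

(* A pi-system generating the sigma-algebra of the first [k] variables. *)
Definition past_boxes (k : nat) : set (set T) :=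
  [set S | exists B : 'I_M -> set R, [/\ forall i, measurable (B i),
    forall i : 'I_M, (k <= i)%N -> B i = setT &
    S = \bigcap_(i in [set: 'I_M]) (theta i @^-1` B i)]].

(** The space T with the smaller sigma-algebra: measurability on it expresses dependence on the
    first k variables only. *)
Definition past (k : nat) := g_sigma_algebraType (past_boxes k).

Lemma past_boxes_setI k : setI_closed (past_boxes k).
Proof.
move=> _ _ [B [mB BT ->]] [B' [mB' BT' ->]]; exists (fun i => B i `&` B' i); split.
- by move=> i; exact: measurableI.
- by move=> i ki; rewrite BT// BT'// setIT.
- by rewrite -bigcapI.
Qed.

Lemma past_measurable k (S : set T) : <<s past_boxes k >> S -> measurable S.
Proof.
apply: smallest_sub; first exact: sigma_algebra_measurable.
move=> _ [B [mB _ ->]]; apply: fin_bigcap_measurable => //.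
by move=> i _; rewrite -[X in measurable X]setTI; exact: measurable_funP.
Qed.

Lemma measurable_theta_past k (j : 'I_M) : (j < k)%N ->
  measurable_fun [set: past k] (theta j : past k -> R).
Proof.
move=> jk _ A mA; rewrite setTI; apply: sub_sigma_algebra.
exists (fun i => if i == j then A else setT); split.
- by move=> i; case: ifP.
- by move=> i ki; case: eqP => // ij; move: ki; rewrite ij leqNgt jk.
apply/seteqP; split => [w /= Aw i _|w /(_ j I)] /=; last by rewrite eqxx.
by case: eqP => [->|].
Qed.

Hypothesis indep : mutually_independent theta.

(** Dynkin's pi-lambda argument: for fixed E, the sets S independent of E are closed under
    complement and disjoint countable union. *)
Lemma past_independent (k : 'I_M) (S : set T) (B : set R) :
  <<s past_boxes k >> S -> measurable B ->
  (P (S `&` theta k @^-1` B) = P S * P (theta k @^-1` B))%E.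
Proof.
move=> sS mB; move: S sS; set E := theta k @^-1` B.
have mE : measurable E by rewrite -[E]setTI; exact: measurable_funP.
have EE : P E = (fine (P E))%:E by rewrite fineK//; exact: fin_num_measure.
apply: (@dynkin_induction _ (past k) (past_boxes k)
  (fun S : set T => P (S `&` E) = P S * P E)%E) => //.
- exact: past_boxes_setI.
- by rewrite setTI probability_setT mul1e.
- move=> _ [A [mA AT ->]].
  (* A box of the past leaves side k free, so B fits there and mutual independence factors both
     probabilities. *)
  pose A' i := if i == k then B else A i.
  have -> : \bigcap_(i in [set: 'I_M]) (theta i @^-1` A i) `&` E =
      \bigcap_(i in [set: 'I_M]) (theta i @^-1` A' i).
    apply/seteqP; split => [w /= [wA wE] i _|w /= wA].
      by rewrite /A' /=; case: eqP => [->//|_]; exact: wA.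
    split; last by have := wA k I; rewrite /A' /= eqxx.
    move=> i _; have := wA i I; rewrite /A' /=; case: eqP => // -> _.
    by rewrite AT.
  rewrite !indep//; last by move=> i; rewrite /A'; case: ifP.
  rewrite (bigD1 k)//= [in RHS](bigD1 k)//= AT// preimage_setT probability_setT mul1e.
  rewrite /A' eqxx muleC; congr (_ * _)%E; apply: eq_bigr => i ik.
  by rewrite (negbTE ik).
- move=> S /past_measurable mS ind.
  have PE : (P E < +oo)%E by rewrite EE ltry.
  have -> : P (~` S `&` E) = (P E - P (S `&` E))%E.
    by rewrite setIC -setDE (measureD mE mS PE) setIC.
  rewrite ind probability_setC// muleBl; first by rewrite mul1e.
    by rewrite EE.
  by rewrite fin_num_adde_defr.
- move=> F mF tF ind; change (nat -> set T) in (type of F).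
  have mF' n : @measurable d T (F n) by exact: past_measurable (mF n).
  have mFE n : @measurable d T (F n `&` E) by exact: measurableI.
  have -> : P (\bigcup_n F n `&` E) = (\sum_(n <oo | n \in [set: nat]) P (F n `&` E))%E.
    rewrite setI_bigcupl; apply: measure_bigcup => //.
    exact: trivIset_setIr.
  have -> : P (\bigcup_n F n) = (\sum_(n <oo | n \in [set: nat]) P (F n))%E.
    exact: measure_bigcup.
  rewrite EE muleC -nneseriesZl//; apply: eq_eseriesr => n _.
  by rewrite ind EE muleC.
Qed.

Lemma independent_past_pair (k : 'I_M) (U : T -> R) (y : R -> R) :
  measurable_fun [set: past k] (U : past k -> R) -> measurable_fun setT y ->
  independent_pair P U (y \o theta k).
Proof.
move=> mU my A B mA mB; rewrite comp_preimage.
have sU : <<s past_boxes k >> (U @^-1` A).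
  by have := mU measurableT A mA; rewrite setTI.
have yB : measurable (y @^-1` B) by have := my measurableT B mB; rewrite setTI.
exact: past_independent sU yB.
Qed.

End Past.

(** * Exponential moments by conditioning on the past *)

Section ExpInequalities.
Variable R : realType.
Implicit Types x y u v : R.

Lemma expRD_expRN_norm x : expR x + expR (- x) = expR `|x| + expR (- `|x|).
Proof. by case: (ger0P x) => // _; rewrite opprK addrC. Qed.

(** Monotonicity of cosh in |x|, from the factorization (q - p) (p q - 1) / (p q) of the difference
    with 1 <= p <= q. *)
Lemma expRD_expRN_le x y : `|x| <= `|y| ->
  expR x + expR (- x) <= expR y + expR (- y).
Proof.
rewrite (expRD_expRN_norm x) (expRD_expRN_norm y) => xy.
rewrite !expRN; set p := expR `|x|; set q := expR `|y|.
have p1 : 1 <= p by rewrite -expR0 ler_expR.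
have pq : p <= q by rewrite ler_expR.
have p0 : 0 < p by exact: expR_gt0.
have q0 : 0 < q by exact: expR_gt0.
rewrite -subr_ge0.
have -> : q + q^-1 - (p + p^-1) = (q - p) * (p * q - 1) / (p * q).
  by field; rewrite !gt_eqF.
rewrite divr_ge0 ?mulr_ge0 ?(ltW p0) ?(ltW q0) ?subr_ge0//.
by rewrite mulr_ege1// (le_trans p1).
Qed.

(** From 1 - x <= exp(- x), exp x - 1 - x is at most 2 cosh x - 2. The linear term stays exact so
    that it can average out. *)
Lemma expR_le_quadratic x y : `|x| <= `|y| ->
  expR x <= 1 + x + (expR y + expR (- y) - 2).
Proof. by move/expRD_expRN_le; have := expR_ge1Dx (- x); lra. Qed.

Lemma sqr_le_expR x : x ^+ 2 <= 4 * (expR x + expR (- x)).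
Proof.
rewrite expRD_expRN_norm -(real_normK (num_real x)); move: `|x| (normr_ge0 x) => y y0.
have h : 1 + y / 2 <= expR (y / 2) by exact: expR_ge1Dx.
have e : expR y = expR (y / 2) ^+ 2 by rewrite expr2 -expRD; congr expR; field.
have p : 0 <= expR (- y) by exact: expR_ge0.
have : (1 + y / 2) ^+ 2 <= expR (y / 2) ^+ 2.
  by rewrite lerXn2r ?nnegrE ?expR_ge0// addr_ge0// divr_ge0.
by rewrite e; nra.
Qed.

(** Here u is the bias and v the variance proxy of one coordinate; the key is 2 exp(v / 2) <= 1 +
    exp v. *)
Lemma expR_mgf_step u v : 0 <= u -> 0 <= v ->
  - 1 + u + 2 * expR (v / 2) <= expR (u + v).
Proof.
move=> u0 v0; rewrite expRD.
have e : expR v = expR (v / 2) ^+ 2 by rewrite expr2 -expRD; congr expR; field.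
have hu : 1 + u <= expR u by exact: expR_ge1Dx.
have hv : 1 <= expR v by rewrite -expR0 ler_expR.
have : (1 + u) * expR v <= expR u * expR v by rewrite ler_wpM2r// expR_ge0.
have : 0 <= (expR (v / 2) - 1) ^+ 2 by rewrite sqr_ge0.
have : 0 <= u * (expR v - 1) by rewrite mulr_ge0// subr_ge0.
by rewrite e; nra.
Qed.

End ExpInequalities.

Section Concentration.
Context (R : realType) (d : measure_display) (T : measurableType d).
Variables (P : probability T R) (M : nat) (theta : 'I_M -> {RV P >-> R}).
Variables (chi : 'I_M -> R -> R) (f : ('I_M -> R) -> R) (delta F A B lambda : R).
Hypothesis law : forall k, distribution P (theta k) = normal_prob 0 1.
Hypothesis indep : mutually_independent theta.
Hypothesis chi_meas : forall k, measurable_fun setT (chi k).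
Hypothesis chi_le : forall k x, `|chi k x| <= delta * `|x|.
Hypothesis chi_mean : forall k, has_mean P (chi k \o theta k) 0.
(** Quantified over measurable spaces, to serve both T and the coarser [past theta k]. *)
Hypothesis f_meas : forall d' (T' : measurableType d') (x : 'I_M -> T' -> R),
  (forall k, measurable_fun setT (x k)) ->
  measurable_fun setT (fun w => f (fun k => x k w)).
Hypothesis f_le : forall x, `|f x| <= F.
Hypothesis f_lip : forall x k y, `|f (upd x k y) - f (upd x k 0)| <= A * `|y|.
Hypothesis f_quad : forall x k, exists m, forall y,
  `|f (upd x k y) - f (upd x k 0) - m * y| <= B * y ^+ 2.
Hypotheses (delta0 : 0 <= delta) (A0 : 0 <= A) (B0 : 0 <= B) (lambda0 : 0 <= lambda).

Lemma has_mean_expR_gaussian k s : has_mean P (fun w => expR (s * theta k w)) (expR (s ^+ 2 / 2)).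
Proof.
have mf : measurable_fun [set: R] (fun x => (expR (s * x))%:E).
  apply/measurable_EFinP; apply: measurableT_comp => //; exact: measurable_funM.
have E : (\int[P]_w (expR (s * theta k w))%:E = (expR (s ^+ 2 / 2))%:E)%E.
  have f0 x : (0 <= (expR (s * x))%:E)%E by rewrite lee_fin expR_ge0.
  have h := @ge0_integral_distribution _ _ _ _ _ P (theta k) _ mf f0.
  by rewrite law in h; apply: (etrans (esym h)); exact: normal_prob_mgf_borel.
split=> //; apply/integrableP; split.
  apply/measurable_EFinP; apply: measurableT_comp => //.
  by apply: measurable_funM => //; exact: measurable_funP.
under eq_integral do rewrite /= (ger0_norm (expR_ge0 _)).
by rewrite E ltry.
Qed.

Let slope_ex x k := cid (f_quad x k).
Let slope x k : R := sval (slope_ex x k).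

Let slopeP x k y : `|f (upd x k y) - f (upd x k 0) - slope x k * y| <= B * y ^+ 2.
Proof. exact: (svalP (slope_ex x k)). Qed.

Let slope_le x k : `|slope x k| <= A + B.
Proof.
have := slopeP x k 1; have := f_lip x k 1.
rewrite normr1 !mulr1 expr1n mulr1; move: (f _) (f _) (slope x k) => p q s.
by rewrite !ler_norml => /andP[? ?] /andP[? ?]; apply/andP; split; lra.
Qed.

(** The slope is picked by choice, but the quadratic bound forces it to be the limit of the
    difference quotients at 1 / (n+1), which are measurable. *)
Let slope_meas d' (T' : measurableType d') (x : 'I_M -> T' -> R) k :
  (forall j, measurable_fun setT (x j)) ->
  measurable_fun setT (fun w => slope (fun j => x j w) k).
Proof.
move=> mx.
have mu y : measurable_fun setT (fun w => f (upd (fun j => x j w) k y)).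
  apply: (f_meas (x := fun j w => if j == k then y else x j w)) => j.
  by case: eqP.
apply: (@measurable_fun_cvg _ _ _ _ (fun n w => n.+1%:R *
  (f (upd (fun j => x j w) k n.+1%:R^-1) - f (upd (fun j => x j w) k 0)))).
  by move=> n; apply: measurable_funM => //; exact: measurable_funB.
move=> w _; move: (fun j => x j w) => z.
apply/cvgrPdist_le => e e0.
have h : ((fun n => B * n.+1%:R^-1) : R^nat) @ \oo --> (B * 0 : R).
  by apply: cvgMr; exact: cvg_invSn.
rewrite mulr0 in h; move/cvgrPdist_le : h => /(_ _ e0); apply: filterS => n.
rewrite sub0r normrN => /(le_trans (ler_norm _)); apply: le_trans.
have n0 : (0 : R) < n.+1%:R by rewrite ltr0n.
have := slopeP z k n.+1%:R^-1.
move: (f (upd z k n.+1%:R^-1)) (f (upd z k 0)) (slope z k) => p q m H.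
have -> : m - n.+1%:R * (p - q) = - (n.+1%:R * (p - q - m * n.+1%:R^-1)).
  by field; rewrite gt_eqF.
rewrite normrN normrM (ger0_norm (ltW n0)) -ler_pdivlMl//.
by apply: le_trans H _; rewrite expr2 mulrC -mulrA [B * _]mulrC.
Qed.

(** Couplings with index at least k are frozen at 0: [X 0] is the unperturbed point and [X M] the
    full vector. *)
Let X (k : nat) (w : T) : 'I_M -> R :=
  fun j => if (j < k)%N then chi j (theta j w) else 0.

Let W k w := expR (lambda * (f (X k w) - f (fun=> 0))).

Let WF k w : `|W k w| <= expR (lambda * (F + F)).
Proof.
rewrite (ger0_norm (expR_ge0 _)) ler_expR ler_wpM2l//.
have := f_le (X k w); have := f_le (fun=> 0).
by rewrite !ler_norml => /andP[? ?] /andP[? ?]; lra.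
Qed.

Let X_past k j : measurable_fun [set: past theta k] (X k ^~ j : past theta k -> R).
Proof.
rewrite /X /=; case: (boolP (j < k)%N) => [jk|_]; last exact: measurable_cst.
have mt := @measurable_theta_past _ _ _ _ _ theta k j jk.
exact: (@measurableT_comp _ _ _ (past theta k) R R _ setT _ (@chi_meas j) mt).
Qed.

Let X_meas k j : measurable_fun setT (X k ^~ j).
Proof.
rewrite /X /=; case: (j < k)%N; last exact: measurable_cst.
by apply: measurableT_comp; first exact: chi_meas.
Qed.

Let W_past k : measurable_fun [set: past theta k] (W k : past theta k -> R).
Proof.
apply: measurableT_comp => //; apply: measurable_funM => //.
apply: measurable_funB => //.
by apply: (@f_meas _ (past theta k) (fun j w => X k w j)) => j; exact: X_past.
Qed.

Let W_meas k : measurable_fun setT (W k).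
Proof.
apply: measurableT_comp => //; apply: measurable_funM => //.
by apply: measurable_funB => //; apply: (@f_meas _ T (fun j w => X k w j)) => j; exact: X_meas.
Qed.

Let b := lambda * B * delta ^+ 2.
Let s := lambda * A * delta.
(** The constant is 1 - 2 from [expR_le_quadratic], the middle term bounds the quadratic error
    through [sqr_le_expR], and the last is 2 cosh(s x). *)
Let Z x := - 1 + b * (4 * (expR x + expR (- x))) + (expR (s * x) + expR (- s * x)).

Let Z_mean k : has_mean P (Z \o theta k) (- 1 + b * (8 * expR (1 / 2)) + 2 * expR (s ^+ 2 / 2)).
Proof.
have h1 := has_mean_expR_gaussian k 1; have h2 := has_mean_expR_gaussian k (- 1).
have h3 := has_mean_expR_gaussian k s; have h4 := has_mean_expR_gaussian k (- s).
rewrite expr1n in h1; rewrite sqrrN expr1n in h2; rewrite sqrrN in h4.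
have := has_meanD (has_meanD (has_mean_cst P (- 1)) (has_meanZ b (has_meanZ 4 (has_meanD h1 h2))))
  (has_meanD h3 h4).
have -> : - 1 + b * (4 * (expR (1 / 2) + expR (1 / 2))) + (expR (s ^+ 2 / 2) + expR (s ^+ 2 / 2))
  = - 1 + b * (8 * expR (1 / 2)) + 2 * expR (s ^+ 2 / 2) by ring.
by under eq_fun do rewrite mul1r mulN1r.
Qed.

Let XS (k : 'I_M) w : X k.+1 w = upd (X k w) k (chi k (theta k w)).
Proof.
apply/funext => j; rewrite /X /upd ltnS leq_eqVlt; case: eqP => [/val_inj ->|jk].
  by rewrite eqxx.
by case: eqP => // jk'; case: jk; rewrite jk'.
Qed.

Let X0 (k : 'I_M) w : X k w = upd (X k w) k 0.
Proof.
apply/funext => j; rewrite /X /upd; case: eqP => // ->.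
by rewrite ltnn.
Qed.

(* Replacing coordinate [k] by its random value costs, up to a term linear in
   [chi k (theta k w)], which averages to 0 given the past, a factor depending
   only on [theta k]. *)
Let W_step (k : 'I_M) w : W k.+1 w <= W k w * Z (theta k w) +
  (lambda * (W k w * slope (X k w) k)) * chi k (theta k w).
Proof.
pose D := lambda * (f (X k.+1 w) - f (X k w)).
have -> : W k.+1 w = W k w * expR D by rewrite -expRD /D; congr expR; ring.
set y := chi k (theta k w); set x := theta k w; set m := slope (X k w) k.
have hD : `|D| <= `|s * x|.
  rewrite /D XS {2}X0 /s !normrM (ger0_norm lambda0) (ger0_norm A0) (ger0_norm delta0).
  rewrite -!mulrA ler_wpM2l//; apply: le_trans (f_lip _ _ _) _.
  by rewrite ler_wpM2l.
have hm : D <= lambda * m * y + b * (4 * (expR x + expR (- x))).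
  have := le_trans (ler_norm _) (slopeP (X k w) k y).
  rewrite -X0 -XS -/m lerBlDr => h.
  have y2 : y ^+ 2 <= delta ^+ 2 * (4 * (expR x + expR (- x))).
    apply: (@le_trans _ _ (delta ^+ 2 * x ^+ 2)); last first.
      by rewrite ler_wpM2l ?sqr_ge0 ?sqr_le_expR.
    rewrite -exprMn -(real_normK (num_real y)) -(real_normK (num_real (_ * x))).
    apply: lerXn2r; rewrite ?nnegrE ?normr_ge0//.
    by rewrite normrM (ger0_norm delta0); exact: chi_le.
  have -> : lambda * m * y + b * (4 * (expR x + expR (- x))) =
    lambda * (B * (delta ^+ 2 * (4 * (expR x + expR (- x)))) + m * y).
    by rewrite /b; ring.
  rewrite ler_wpM2l//; apply: le_trans h _.
  by rewrite lerD2r ler_wpM2l.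
have -> : W k w * Z x + lambda * (W k w * m) * y = W k w * (Z x + lambda * m * y) by ring.
rewrite ler_wpM2l ?expR_ge0//; apply: le_trans (expR_le_quadratic hD) _.
by rewrite /Z mulNr; lra.
Qed.

Let c := b * (8 * expR (1 / 2)) + s ^+ 2.

Let mgf_le k : (k <= M)%N -> exists e, has_mean P (W k) e /\ e <= expR (k%:R * c).
Proof.
elim: k => [|k ih] kM.
  exists 1; split; last by rewrite mul0r expR0.
  have := has_mean_cst P 1; congr (has_mean P _ _); apply/funext => w.
  by rewrite /W /X subrr mulr0 expR0.
have [e [he le]] := ih (ltnW kM); pose K := Ordinal kM.
have [e1 he1] := has_mean_bounded P (@W_meas k.+1) (WF k.+1).
have US_meas : measurable_fun setT (fun w => lambda * (W k w * slope (X k w) K)).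
  apply: measurable_funM => //; apply: measurable_funM => //.
  by apply: (@slope_meas _ _ (fun j w => X k w j)) => j; exact: X_meas.
have US_past : measurable_fun [set: past theta k]
    (fun w : past theta k => lambda * (W k w * slope (X k w) K)).
  apply: measurable_funM => //; apply: measurable_funM => //.
  by apply: (@slope_meas _ (past theta k) (fun j w => X k w j)) => j; exact: X_past.
have US_le w : `|lambda * (W k w * slope (X k w) K)| <=
    lambda * (expR (lambda * (F + F)) * (A + B)).
  rewrite normrM (ger0_norm lambda0) ler_wpM2l// normrM.
  by apply: ler_pM => //; exact: WF.
have [e2 he2] := has_mean_bounded P US_meas US_le.
have Z_meas : measurable_fun setT Z.
  have me r : measurable_fun setT (fun x : R => expR (r * x)).
    by apply: measurableT_comp => //; exact: measurable_funM.
  apply: measurable_funD; last by apply: measurable_funD; exact: me.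
  apply: measurable_funD => //; apply: measurable_funM => //; apply: measurable_funM => //.
  by apply: measurable_funD => //; exact: measurableT_comp.
(* Both products pair a factor from the past with one from the new Gaussian; in the second, the new
   factor is centered, so the linear term has mean 0. *)
have i1 := @independent_past_pair _ _ _ _ _ _ indep K (W k) Z (W_past (k := k)) Z_meas.
have i2 := @independent_past_pair _ _ _ _ _ _ indep K _ _ US_past (chi_meas K).
have h := has_meanD (has_meanM i1 (WF k) he (Z_mean K)) (has_meanM i2 US_le he2 (chi_mean K)).
exists e1; split => //.
have e1le := has_mean_le he1 h (W_step K).
rewrite mulr0 addr0 in e1le; apply: le_trans e1le _.
have -> : k.+1%:R * c = k%:R * c + c by rewrite -natr1 mulrDl mul1r.
rewrite expRD.
have e0 : 0 <= e by apply: (has_mean_le (has_mean_cst P 0) he) => w; exact: expR_ge0.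
apply: (@le_trans _ _ (e * expR c)); last by rewrite ler_wpM2r// expR_ge0.
rewrite ler_wpM2l//; apply: expR_mgf_step; last exact: sqr_ge0.
by rewrite /b !mulr_ge0// ?sqr_ge0// expR_ge0.
Qed.

Lemma has_mean_expR_le : exists e,
  has_mean P (fun w => expR (lambda * (f (fun k => chi k (theta k w)) - f (fun=> 0)))) e /\
  e <= expR (M%:R * (lambda * B * delta ^+ 2 * (8 * expR (1 / 2)) + (lambda * A * delta) ^+ 2)).
Proof.
have XM w : X M w = (fun k => chi k (theta k w)).
  by apply/funext => k; rewrite /X ltn_ord.
have -> : (fun w => expR (lambda * (f (fun k => chi k (theta k w)) - f (fun=> 0)))) = W M.
  by apply/funext => w; rewrite /W XM.
exact: mgf_le.
Qed.

End Concentration.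

(** * Tail bounds and the theorem *)

Section TailBound.
Context (R : realType) (d : measure_display) (T : measurableType d).
Variable P : probability T R.

Lemma measurable_superlevel (Y : T -> R) (r : R) : measurable_fun setT Y ->
  measurable [set w | (r < Y w)%R].
Proof.
move=> mY; rewrite (_ : [set w | _] = Y @^-1` `]r, +oo[%classic).
  by rewrite -[X in measurable X]setTI; exact: mY.
by apply/seteqP; split => w; rewrite /= in_itv /= andbT.
Qed.

Lemma has_mean_expR_markov (Y : T -> R) (lambda r e : R) : 0 <= lambda ->
  measurable_fun setT Y -> has_mean P (fun w => expR (lambda * Y w)) e ->
  (P [set w | (r < Y w)%R] <= (expR (- (lambda * r)) * e)%:E)%E.
Proof.
move=> l0 mY he; set S := [set w | (r < Y w)%R].
have mS : measurable S by exact: measurable_superlevel.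
have hS : has_mean P (\1_S) (fine (P S)).
  have E : (\int[P]_w (\1_S w)%:E = P S)%E by rewrite integral_indic// setIT.
  split; last by rewrite E fineK// fin_num_measure.
  by apply: integrable_indic => //; rewrite ltey_eq fin_num_measure.
rewrite -[leLHS]fineK ?fin_num_measure// lee_fin.
apply: (has_mean_le hS (has_meanZ (expR (- (lambda * r))) he)) => w.
rewrite indicE -expRD; have [|_] := boolP (w \in S); last by rewrite expR_ge0.
rewrite inE /S /= => rY; rewrite -[leLHS]expR0 ler_expR addrC subr_ge0.
by rewrite ler_wpM2l// ltW.
Qed.

Lemma subgaussian_tail (Y : T -> R) (D S tau : R) : 0 < S -> 0 <= tau ->
  measurable_fun setT Y ->
  (forall lambda, 0 <= lambda -> exists e,
    has_mean P (fun w => expR (lambda * Y w)) e /\ e <= expR (lambda * D + lambda ^+ 2 * S)) ->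
  (P [set w | (tau + D < Y w)%R] <= (expR (- (tau ^+ 2 / (4 * S))))%:E)%E.
Proof.
(* The minimizer of lambda^2 S - lambda tau, with value - tau^2 / (4 S); the bias D cancels against
   the shift of the threshold. *)
move=> S0 tau0 mY h; pose l := tau / (2 * S).
have l0 : 0 <= l by rewrite divr_ge0// mulr_ge0// ltW.
have [e [he le]] := h l l0.
apply: le_trans (has_mean_expR_markov (tau + D) l0 mY he) _; rewrite lee_fin.
apply: le_trans (ler_wpM2l (expR_ge0 _) le) _; rewrite -expRD ler_expR.
have -> // : - (l * (tau + D)) + (l * D + l ^+ 2 * S) = - (tau ^+ 2 / (4 * S)).
by rewrite /l; field; rewrite gt_eqF.
Qed.

Lemma probability_two_sided (Y : T -> R) (r p : R) : measurable_fun setT Y ->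
  (P [set w | (r < Y w)%R] <= p%:E)%E -> (P [set w | (r < - Y w)%R] <= p%:E)%E ->
  ((1 - 2 * p)%:E <= P [set w | (`|Y w| <= r)%R])%E.
Proof.
move=> mY h1 h2.
have mY' : measurable_fun setT (fun w => - Y w) by exact: measurableT_comp.
have -> : [set w | (`|Y w| <= r)%R] =
    ~` ([set w | (r < Y w)%R] `|` [set w | (r < - Y w)%R]).
  apply/seteqP; split => w /=; rewrite ler_norml.
    by move=> /andP[a b] []; rewrite ltNge => /negP; apply; lra.
  move=> /not_orP[/negP + /negP]; rewrite -!leNgt => a b.
  by apply/andP; split; lra.
rewrite probability_setC; last by apply: measurableU; exact: measurable_superlevel.
rewrite EFinB leeB//; apply: (le_trans (measureU2 _ _ _));
  [exact: measurable_superlevel|exact: measurable_superlevel|].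
by rewrite mulr_natl mulr2n EFinD leeD.
Qed.

End TailBound.

(** * Regularity and growth of the deformation *)

Section ChiFacts.
Variables (R : realType) (chi : R -> R) (delta : R) (Gamma : \bar R).
Hypothesis hchi : chi_deformation chi delta Gamma.

Let chi_derivable x : derivable chi x 1. Proof. by have [_ [/(_ x)[]]] := hchi. Qed.

Let chi_continuous : continuous chi.
Proof. by move=> x; apply/differentiable_continuous/derivable1_diffP. Qed.

Lemma chi_deformation_measurable : measurable_fun setT chi.
Proof. exact: continuous_measurable_fun. Qed.

(** The mean value theorem between 0 and x, as chi vanishes at 0. *)
Lemma chi_deformation_le x : `|chi x| <= delta * `|x|.
Proof.
have [_ [hd [chi0 _]]] := hchi.
have lip a b : a <= b -> `|chi b - chi a| <= delta * (b - a).
  move=> ab.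
  have hder y : y \in `]a, b[ -> is_derive y 1 chi (derive1 chi y).
    by move=> _; rewrite derive1E; apply/derivableP.
  have [y _ ->] := MVT_segment ab hder (continuous_subspaceT chi_continuous).
  by rewrite normrM (ger0_norm (x := b - a)) ?subr_ge0// ler_wpM2r ?subr_ge0//; have [] := hd y.
have [x0|x0] := leP 0 x.
  by have := lip _ _ x0; rewrite chi0 !subr0 (ger0_norm x0).
by have := lip _ _ (ltW x0); rewrite chi0 !sub0r normrN (ltr0_norm x0).
Qed.

End ChiFacts.

(** * Concentration of the Heisenberg expectation *)

Section HeisenbergConcentration.
Variable R : realType.
Local Notation C := R[i].
Variables (n M : nat) (rho H O : 'M[C]_n) (V : 'I_M -> 'M[C]_n) (t w : R).
Hypotheses (hrho : density_matrix rho) (hH : hermitian_mx H) (hO : hermitian_mx O).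
Hypotheses (hV : forall k, hermitian_mx (V k)) (bV : forall k, bnd (V k) 1).
Hypotheses (bO : bnd O w) (t0 : 0 <= t).

Definition heis_fun (x : 'I_M -> R) : R :=
  complex.Re (heis_expect rho (perturbed H V x) O t).

Lemma heis_fun_le x : `|heis_fun x| <= w.
Proof.
exact: Re_heis_expect_le hrho (hermitian_perturbed x hH hV) bO.
Qed.

Lemma heis_fun_lip x k y :
  `|heis_fun (upd x k y) - heis_fun (upd x k 0)| <= 2 * w * t * `|y|.
Proof.
have := Re_heis_expectB_le hrho (hermitian_perturbed (upd x k 0) hH hV) (hV k) (bV k) bO t0 y.
by rewrite -!perturbed_upd.
Qed.

Lemma heis_fun_quad x k : exists m, forall y,
  `|heis_fun (upd x k y) - heis_fun (upd x k 0) - m * y| <= 3 * w * t ^+ 2 * y ^+ 2.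
Proof.
have [m hm] := Re_heis_expect_quadratic hrho
  (hermitian_perturbed (upd x k 0) hH hV) (hV k) (bV k) bO t0.
by exists m => y; have := hm y; rewrite -!perturbed_upd.
Qed.

Lemma measurable_heis_fun d (T : measurableType d) (x : 'I_M -> T -> R) :
  (forall k, measurable_fun setT (x k)) ->
  measurable_fun setT (fun u => heis_fun (fun k => x k u)).
Proof. by move=> hx; apply: measurable_Re_heis_expect; exact: measurablemx_perturbed. Qed.

Lemma normc_heis_expectB x :
  Normc.normc (heis_expect rho (perturbed H V x) O t - heis_expect rho H O t) =
  `|heis_fun x - heis_fun (fun=> 0)|.
Proof.
have [hr _] := hrho; rewrite /heis_fun perturbed0.
have := Im_heis_expect t hr (hermitian_perturbed x hH hV) hO.
have := Im_heis_expect t hr hH hO.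
case: (heis_expect _ _ _ _) (heis_expect _ _ _ _) => [a b] [p q] /= -> ->.
by rewrite subr0 expr0n addr0 sqrtr_sqr.
Qed.

(** The degenerate cases, in which the variance proxy that the tail bound divides by may vanish. *)
Lemma heis_fun_trivial x : w = 0 \/ t = 0 \/ M = 0%N -> heis_fun x = heis_fun (fun=> 0).
Proof.
move=> [w0|[t00|M0]].
- have f0 y : heis_fun y = 0.
    by apply/eqP; rewrite -normr_eq0 eq_le normr_ge0 andbT -w0 heis_fun_le.
  by rewrite !f0.
- by rewrite /heis_fun /heis_expect t00 oppr0 -[0 +i* 0]/(0 : C) !scale0r.
- by congr heis_fun; apply/funext => k; have := ltn_ord k; rewrite {2}M0.
Qed.

Context (d : measure_display) (T : measurableType d).
Variables (P : probability T R) (theta : 'I_M -> {RV P >-> R}) (chi : 'I_M -> R -> R).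
Variables (delta : R) (Gamma : \bar R).
Hypothesis law : forall k, distribution P (theta k) = normal_prob 0 1.
Hypothesis indep : mutually_independent theta.
Hypothesis hchi : forall k, chi_deformation (chi k) delta Gamma.
Hypothesis chi_mean : forall k, ('E_P[chi k \o theta k] = 0)%E.
Hypothesis delta0 : 0 <= delta.

Let g u : 'I_M -> R := fun k => chi k (theta k u).

Let Y u := heis_fun (g u) - heis_fun (fun=> 0).

Let w0 : 0 <= w. Proof. exact: bnd_ge0 bO. Qed.

(** A zero expectation does not by itself give integrability; domination by delta (exp theta + exp(-
    theta)) does. *)
Let chi_has_mean k : has_mean P (chi k \o theta k) 0.
Proof.
have mc := chi_deformation_measurable (hchi k).
have h1 := has_mean_expR_gaussian law k 1; have h2 := has_mean_expR_gaussian law k (- 1).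
have hb := has_meanZ delta (has_meanD h1 h2).
have le u : `|(chi k \o theta k) u| <= delta * (expR (1 * theta k u) + expR (- 1 * theta k u)).
  apply: le_trans (chi_deformation_le (hchi k) _) _; rewrite ler_wpM2l// mul1r mulN1r.
  rewrite expRD_expRN_norm; have := expR_ge1Dx `|theta k u|.
  by have := expR_ge0 (- `|theta k u|); lra.
have mX : measurable_fun setT (chi k \o theta k) by exact: measurableT_comp.
have [e [iX EX]] := has_mean_le_integrable mX hb le.
have e0 := chi_mean k; rewrite unlock EX in e0.
by case: e0 => <-.
Qed.

Let measurable_g k : measurable_fun setT (fun u => g u k).
Proof.
by apply: measurableT_comp; first exact: chi_deformation_measurable (hchi k).
Qed.

Lemma measurable_heis_diff : measurable_fun setT Y.
Proof. by apply: measurable_funB => //; exact: (measurable_heis_fun measurable_g). Qed.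

(** The slice bounds are invariant under a change of sign, so both tails come from one statement. *)
Lemma heis_mgf_le (s lambda : R) : s = 1 \/ s = - 1 -> 0 <= lambda ->
  exists e, has_mean P (fun u => expR (lambda * (s * Y u))) e /\
  e <= expR (M%:R * (lambda * (3 * w * t ^+ 2) * delta ^+ 2 * (8 * expR (1 / 2))
             + (lambda * (2 * w * t) * delta) ^+ 2)).
Proof.
move=> hs l0; have s1 : `|s| = 1 by case: hs => ->; rewrite ?normrN normr1.
have hm d' (T' : measurableType d') (x : 'I_M -> T' -> R) :
    (forall k, measurable_fun setT (x k)) ->
    measurable_fun setT (fun u => s * heis_fun (fun k => x k u)).
  by move=> hx; apply: measurable_funM => //; exact: measurable_heis_fun.
have hle x : `|s * heis_fun x| <= w by rewrite normrM s1 mul1r heis_fun_le.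
have hlip x k y : `|s * heis_fun (upd x k y) - s * heis_fun (upd x k 0)| <= 2 * w * t * `|y|.
  by rewrite -mulrBr normrM s1 mul1r heis_fun_lip.
have hquad x k : exists m, forall y,
    `|s * heis_fun (upd x k y) - s * heis_fun (upd x k 0) - m * y| <= 3 * w * t ^+ 2 * y ^+ 2.
  have [m hmy] := heis_fun_quad x k; exists (s * m) => y.
  by rewrite -mulrA -!mulrBr normrM s1 mul1r.
have A0 : 0 <= 2 * w * t by rewrite !mulr_ge0.
have B0 : 0 <= 3 * w * t ^+ 2 by rewrite !mulr_ge0// sqr_ge0.
have [e he] := has_mean_expR_le law indep
  (fun k => chi_deformation_measurable (hchi k)) (fun k => chi_deformation_le (hchi k))
  chi_has_mean hm hle hlip hquad delta0 A0 B0 l0.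
exists e; rewrite /Y; under eq_fun do rewrite mulrBr.
exact: he.
Qed.

Lemma heis_concentration (K tau : R) : M%:R <= K -> 0 < K -> 0 <= tau ->
  0 < w -> 0 < t -> 0 < delta ->
  ((1 - 2 * expR (- (tau ^+ 2 / (16 * K * (w * t * delta) ^+ 2))))%:E <=
   P [set u | (`|Y u| <= tau + K * (24 * expR (1 / 2)) * (w * t ^+ 2 * delta ^+ 2))%R])%E.
Proof.
move=> MK K0 tau0 wp tp dp; have mY := measurable_heis_diff.
(* D adds up K biases, with 24 = 3 * 8, and S adds up K squared Lipschitz constants
   [2 * w * t * delta]. *)
set D := K * _ * _; pose S := K * (2 * w * t * delta) ^+ 2.
have S0 : 0 < S by rewrite mulr_gt0// exprn_gt0// !mulr_gt0.
have -> : 16 * K * (w * t * delta) ^+ 2 = 4 * S by rewrite /S; ring.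
have tail s : s = 1 \/ s = - 1 ->
    (P [set u | (tau + D < s * Y u)%R] <= (expR (- (tau ^+ 2 / (4 * S))))%:E)%E.
  move=> hs; apply: subgaussian_tail => //.
    by apply: measurable_funM => //; exact: mY.
  move=> lambda l0; have [e [he le]] := heis_mgf_le hs l0.
  exists e; split => //; apply: le_trans le _; rewrite ler_expR.
  have -> : lambda * D + lambda ^+ 2 * S =
    K * (lambda * (3 * w * t ^+ 2) * delta ^+ 2 * (8 * expR (1 / 2))
             + (lambda * (2 * w * t) * delta) ^+ 2) by rewrite /D /S; ring.
  rewrite ler_wpM2r// addr_ge0 ?sqr_ge0//.
  by rewrite !mulr_ge0// ?sqr_ge0// expR_ge0.
apply: probability_two_sided => //.
  by have := tail 1 (or_introl erefl); under eq_set do rewrite mul1r.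
by have := tail (- 1) (or_intror erefl); under eq_set do rewrite mulN1r.
Qed.

End HeisenbergConcentration.

(* Constants hidden in the O(.) notation: CM (for M = O(N)), C0 (for
   sqrt(N) t delta <= O(1)), the lattice dimension D and the locality range r
   are given; the constants C1, C2 of the conclusion and the absolute constant
   c > 0 are then asserted to exist, uniformly in everything else. *)
Theorem theorem1 (R : realType) (D r : nat) (CM C0 : R) :
  0 < CM -> 0 < C0 ->
  exists C1 C2 c : R, 0 < C1 /\ 0 < C2 /\ 0 < c /\
  forall (N M : nat) (pos : 'I_N -> 'I_D -> int)
         (H : 'M[R[i]]_(2 ^ N)) (V : 'I_M -> 'M[R[i]]_(2 ^ N))
         (d : measure_display) (T : measurableType d) (P : probability T R)
         (theta : 'I_M -> {RV P >-> R}) (chi : 'I_M -> R -> R)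
         (delta : R) (Gamma : \bar R) (t : R)
         (rho O : 'M[R[i]]_(2 ^ N)) (a : R),
    lattice_embedding pos ->
    hermitian_mx H ->
    (M%:R <= CM * N%:R) ->
    (forall k, hermitian_mx (V k) /\ local_op pos r (V k) /\ opnorm (V k) <= 1) ->
    0 < delta -> (0 < Gamma)%E ->
    (forall k, distribution P (theta k) = normal_prob 0 1) ->
    mutually_independent theta ->
    (forall k, chi_deformation (chi k) delta Gamma /\
               ('E_P[chi k \o theta k] = 0)%E) ->
    0 <= t ->
    Num.sqrt (N%:R) * t * delta <= C0 ->
    density_matrix rho ->
    hermitian_mx O ->
    0 < a ->
    let H' := fun w : T => H + \sum_(k < M) (Complex (chi k (theta k w)) 0 *: V k) in
    (P [set w | (Normc.normc (heis_expect rho (H' w) O t - heis_expect rho H O t)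
                  <= C1 * a * Num.sqrt (N%:R) * t * delta * opnorm O
                     + C2 * N%:R * t ^+ 2 * delta ^+ 2 * opnorm O)%R]
       >= (1 - 2 * expR (- (c * a ^+ 2)))%:E)%E.
Proof.
(* With K = CM N, the exponent tau^2 / (16 K (w t delta)^2) equals a^2 for tau = 4 sqrt(CM) a
   sqrt(N) t delta w; hence c = 1. *)
move=> CM0 C00; exists (4 * Num.sqrt CM), (CM * (24 * expR (1 / 2))), 1.
have sCM : 0 < Num.sqrt CM by rewrite sqrtr_gt0.
split; first by rewrite mulr_gt0.
split; first by rewrite !mulr_gt0// expR_gt0.
split; first exact: ltr01.
move=> N M pos H V d T P theta chi delta Gamma t rho O a.
move=> _ hH hM hV delta0 _ law indep hchi t0 _ hrho hO a0; cbv zeta.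
have hVh k : hermitian_mx (V k) by have [] := hV k.
have bV k : bnd (V k) 1 by have [_ [_ oV]] := hV k; apply: bnd_le oV (bnd_opnorm _).
have bO := bnd_opnorm O; have w0 := bnd_ge0 bO.
set w := opnorm O in bO w0 *; set n : R := N%:R in hM *.
have n0 : 0 <= n by rewrite ler0n.
pose x u : 'I_M -> R := fun k => chi k (theta k u).
have E u : Normc.normc (heis_expect rho
      (H + \sum_(k < M) (Complex (chi k (theta k u)) 0 *: V k)) O t - heis_expect rho H O t) =
    `|heis_fun rho H O V t (x u) - heis_fun rho H O V t (fun=> 0)|.
  exact: (normc_heis_expectB t hrho hH hO hVh (x u)).
under eq_set do rewrite E.
set tau := 4 * Num.sqrt CM * a * Num.sqrt n * t * delta * w.
have -> : CM * (24 * expR (1 / 2)) * n * t ^+ 2 * delta ^+ 2 * w =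
    CM * n * (24 * expR (1 / 2)) * (w * t ^+ 2 * delta ^+ 2) by ring.
have tau0 : 0 <= tau by rewrite !mulr_ge0 ?sqrtr_ge0// ltW.
have [triv|nontriv] := pselect (w = 0 \/ t = 0 \/ n = 0).
  have triv' : w = 0 \/ t = 0 \/ M = 0%N.
    case: triv => [|[|nz]]; [by left|by right; left|right; right].
    by move: hM; rewrite nz mulr0 lern0 => /eqP.
  have -> : [set u | (`|heis_fun rho H O V t (x u) - heis_fun rho H O V t (fun=> 0)|
      <= tau + CM * n * (24 * expR (1 / 2)) * (w * t ^+ 2 * delta ^+ 2))%R] = setT.
    apply/seteqP; split => // u _ /=.
    rewrite (heis_fun_trivial hrho hH hVh bO (x u) triv') subrr normr0.
    by rewrite addr_ge0// !mulr_ge0 ?expR_ge0 ?sqr_ge0// ltW.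
  rewrite probability_setT lee_fin gerBl// mulr_ge0// expR_ge0.
have [wn [tn nn]] : w != 0 /\ t != 0 /\ n != 0.
  by split; [|split]; apply/eqP => h; apply: nontriv; [left|right; left|right; right].
have wp : 0 < w by rewrite lt_def wn.
have tp : 0 < t by rewrite lt_def tn.
have np : 0 < n by rewrite lt_def nn.
have -> : 1 * a ^+ 2 = tau ^+ 2 / (16 * (CM * n) * (w * t * delta) ^+ 2).
  rewrite /tau !exprMn !sqr_sqrtr ?(ltW CM0)//.
  by field; rewrite !gt_eqF.
apply: (heis_concentration hrho hH hVh bV bO t0 law indep (fun k => (hchi k).1)
  (fun k => (hchi k).2) (ltW delta0)) => //.
exact: mulr_gt0.
Qed.
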